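(* There exist $T\in(0,\infty)$ and drivers $\xi_n,\tilde\xi_n\in S_0([0,T])$ such that $\|\xi_n-\tilde\xi_n\|_{\infty[0,T]}\to0$ but for which there exist a point $x$ welded by both $\xi_n$ and $\tilde\xi_n$ (for every $n$) and $\epsilon>0$ such that $$|\varphi_n(x)-\tilde\varphi_n(x)|\ge\epsilon$$ for all $n$, where $\varphi_n$ and $\tilde\varphi_n$ are the conformal weldings for $\xi_n$ and $\tilde\xi_n$, respectively.
   Context: A driver is a continuous function $\xi:[0,T]\to\mathbb{R}$. The upwards Loewner flow of $\xi$ in the upper half plane $\mathbb{H}$ is the solution of $\partial_t h_t(z)=\frac{-2}{h_t(z)-\xi(t)}$, $h_0(z)=z$; for $z\in\mathbb{H}$ it exists on all of $[0,T]$. Hitting times: for $x\in\mathbb{R}\setminus\{\xi(0)\}$, let $x(t)=h_t(x;\xi)$ be the real solution of the same ODE started at $x$, and let $\tau(x;\xi):=\inf\{t\ge 0: \liminf_{s\nearrow t}|x(s)-\xi(s)|=0\}$ (with $t\in[0,T]$ and $\inf\emptyset=+\infty$); also $\tau(\xi(0);\xi)=0$. A point $x$ is welded by $\xi$ if $\tau(x;\xi)<\infty$. Simple-curve drivers: $S([0,T])$ is the set of continuous $\xi:[0,T]\to\mathbb{R}$ that generate a simple curve, i.e. there is an injective continuous $\gamma:[0,T]\to\mathbb{H}\cup\{\xi(T)\}$ with $\gamma(0)=\xi(T)$ and $\gamma((0,T])\subset\mathbb{H}$ such that $h_T$ maps $\mathbb{H}$ conformally onto $\mathbb{H}\setminus\gamma((0,T])$.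 $S_0([0,T])$ is the set of $\xi\in S([0,T])$ with $\xi(0)=0$. Conformal welding: for $\xi\in S_0([0,T])$, $T<\infty$, the hitting time function is finite exactly on a compact interval $[-a,b]$ with $-a<0<b$, is continuous there, strictly decreasing on $[-a,0]$ and strictly increasing on $[0,b]$, with $\tau(-a)=\tau(b)=T$. With $\tau_-=\tau|_{[-a,0]}$, $\tau_+=\tau|_{[0,b]}$, the conformal welding of $\xi$ is the homeomorphism $\varphi=\tau_+^{-1}\circ\tau_-:[-a,0]\to[0,b]$, i.e. $\tau(x)=\tau(\varphi(x))$. *)

(* Defs.v *)
From HB Require Import structures.
From mathcomp Require Import all_boot all_order all_algebra.
From mathcomp Require Import complex.
From mathcomp Require Import all_classical all_reals all_analysis.

Set Implicit Arguments.
Unset Strict Implicit.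
Unset Printing Implicit Defensive.

Import Order.TTheory GRing.Theory Num.Theory.
Import numFieldNormedType.Exports.

Local Open Scope classical_set_scope.
Local Open Scope ring_scope.
Local Open Scope complex_scope.

(* The equation h'(t) = -2 / (h(t) - xi(t)), h(0) = z, on a set D of times
   containing 0, for K-valued h; iota : R -> K is the inclusion of the reals.
   It is used with K = R[i] for points of the half plane and with K = R for
   points of the real line.  The time derivative is taken within D, hence it is
   one-sided at the end points of an interval.  Since division is total, the
   denominator has to be required to be nonzero. *)
Definition loewner_solution (R : realType) (K : numFieldType) (iota : R -> K)
    (D : set R) (xi : R -> R) (z : K) (h : R -> K) : Prop :=
  h 0 = z /\
  forall t, D t ->
    h t != iota (xi t) /\
    (fun s => (h s - h t) / iota (s - t)) @ within D (dnbhs t)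
      --> - 2 / (h t - iota (xi t)).

Definition upper_half_plane {R : realType} : set R[i] :=
  [set z | 0 < complex.Im z].

Definition upward_loewner_flow (R : realType) (T : R) (xi : R -> R)
    (h : R -> R[i] -> R[i]) : Prop :=
  forall z, upper_half_plane z ->
    loewner_solution (real_complex R) `[0, T] xi z (fun t => h t z).

(* Complex differentiability is differentiability along 1 in the R[i]-normed
   module R[i]. *)
Definition conformal_onto (R : realType) (U V : set R[i]) (f : R[i] -> R[i])
    : Prop :=
  (forall z, U z -> derivable (f : R[i]^o -> R[i]^o) z 1) /\ set_bij U V f.

Definition generates_simple_curve (R : realType) (T : R) (xi : R -> R) : Prop :=
  exists (h : R -> R[i] -> R[i]) (gamma : R -> R[i]),
    [/\ upward_loewner_flow T xi h,
        {within `[0, T], continuous (gamma : R -> R[i]^o)},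
        {in `[0, T] &, injective gamma},
        gamma 0 = (xi T)%:C /\
        gamma @` `]0, T] `<=` upper_half_plane
      & conformal_onto (upper_half_plane)
          (upper_half_plane `\` gamma @` `]0, T]) (h T)].

(* Only the values of a driver on [0, T] matter. *)
Definition simple_curve_driver (R : realType) (T : R) (xi : R -> R) : Prop :=
  {within `[0, T], continuous xi} /\ generates_simple_curve T xi.

Definition simple_curve_driver0 (R : realType) (T : R) (xi : R -> R) : Prop :=
  simple_curve_driver T xi /\ xi 0 = 0.

(* The real solution started at x is only defined up to the time it meets xi,
   so t is a hitting time if there is a solution on [0, t[ coming arbitrarily
   close to xi as time increases to t.  The infimum over the empty set is +oo. *)
Definition hitting_time (R : realType) (T : R) (xi : R -> R) (x : R) : \bar R :=
  if x == xi 0 then 0%E else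
  ereal_inf (EFin @` [set t : R | 0 < t <= T /\
    exists y : R -> R, loewner_solution id `[0, t[ xi x y /\
      limf_einf (fun s => `|y s - xi s|%:E) (at_left t) = 0%E]).

Definition welded (R : realType) (T : R) (xi : R -> R) (x : R) : Prop :=
  (hitting_time T xi x < +oo)%E.

(* phi = tau_+^-1 \o tau_-, with tau_- and tau_+ the hitting time on the welded
   points that are <= 0, resp. >= 0; for xi in S_0 these are the intervals
   [-a, 0] and [0, b].  The value is meaningful for welded x <= 0. *)
Definition conformal_welding (R : realType) (T : R) (xi : R -> R) (x : R) : R :=
  pinv [set y | 0 <= y /\ welded T xi y] (hitting_time T xi)
    (hitting_time T xi x).

Definition sup_norm (R : realType) (T : R) (f : R -> R) : R :=
  sup [set `|f t| | t in `[0, T]].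

(* Main.v *)
Require Import Defs.
From mathcomp Require Import all_boot all_order all_algebra.
From mathcomp Require Import complex.
From mathcomp Require Import ring lra.
From mathcomp Require Import all_classical all_reals all_analysis.
Import Order.TTheory GRing.Theory Num.Theory.
Import numFieldNormedType.Exports.
Local Open Scope classical_set_scope.
Local Open Scope ring_scope.

(** Under the zero driver the point -2 moves as -2 sqrt(1 - t) and is hit at
    time 1, together with 2.  Just before time 1 it is at a tiny distance d
    from the driver, and a driver which then starts to move to the right at a
    speed comparable to 1 / d keeps it away for a macroscopic time.  Starting
    the motion at time 1, or at the time s < 1 when the distance is d, changes
    the driver by O(sqrt(1 - s)) = O(d) only, but in the first case -2 is
    welded to 2, and in the second one it is hit when the driver has reached a
    level above 3.  Points to the right of the driver only move to the left, so
    that the partner of -2 must start above 3.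

    For this to give explicit simple curves, the driver is 0 up to time s and
    3 (r(t) - rho) afterwards, where r(t)^2 = rho^2 + 2 (t - s).  Up to time s
    the flow is h = sqrt(z^2 - 4 t), with values off a vertical slit.
    Afterwards set k = h - xi(t) + r(t); the label Q = (k + r)^2 / k does not
    depend on time ([slope_arc]), so that k is a root of the quadratic equation
    k^2 - (Q - 2 r) k + r^2 = 0.  As Q - 2 r = k + r^2 / k, the
    Joukowsky map, k |-> Q is a bijection from the upper half plane onto the
    plane cut along the rays (-oo, 0] and [4 r, oo) ([arc_chart_upper],
    [arc_chartK], [arc_inverse_upper], [arc_inverseK]).  When r grows from rho
    the second ray loses [4 rho, 4 r), which corresponds to an arc of the
    circle |k| = r: at the final time the values omitted by the flow are this
    arc continued by the image of the vertical slit ([slit_map_range],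
    [slit_map_surj]).  Hence each of these drivers generates a simple curve
    ([driver_simple_curve]).

    The same formulas with real square roots solve the equation on the real
    line.  Real solutions are unique by a Gronwall argument
    ([solution_unique]), so that a hitting time can be read off from any
    solution which meets the driver ([hitting_time_hits]).  A point with label
    Q is hit when 4 r(t) = Q, and two real points have the same label if
    the product of their values of k at time s is rho^2 ([fast_hits]). *)

Set Implicit Arguments.
Unset Strict Implicit.
Unset Printing Implicit Defensive.

(** * Difference quotients along a filter *)

Section slope_calculus.
Variables (I : Type) (K : numFieldType) (F : set_system I).
Context {FF : Filter F}.
Variable e : I -> K.
Hypotheses (e0 : e @ F --> 0) (eN0 : \forall i \near F, e i != 0).

(** The difference quotients of f for the increments e tend to a.  One notion
    covers both derivatives that are needed: the derivative in time of a
    K-valued function, with F the punctured neighbourhoods of an instant within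
    a set of times and e the increment of time cast to K, and the derivative in
    the complex variable. *)
Definition slope (f : I -> K) (f0 a : K) : Prop :=
  (fun i => (f i - f0) / e i) @ F --> a.

Let cstc (c : K) : (fun=> c) @ F --> c.
Proof. exact: cvg_cst. Qed.

Let eq_lim (f g : I -> K) (l : K) : f =1 g -> f @ F --> l -> g @ F --> l.
Proof. by move=> /funext ->. Qed.

Lemma slope_cvg f f0 a : slope f f0 a -> f @ F --> f0.
Proof.
move=> fa.
pose proof (cvgD (cvgM fa e0) (@cstc f0)) as lim.
rewrite mulr0 add0r in lim; apply: (cvg_trans _ lim); apply: near_eq_cvg.
by near=> i; rewrite !fctE /= divfK ?subrK//; near: i.
Unshelve. all: by end_near. Qed.

Lemma slope_cst c : slope (fun=> c) c 0.
Proof.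
rewrite /slope (_ : (fun i => (c - c) / e i) = (fun=> 0)); first exact: cvg_cst.
by apply/funext => i; rewrite subrr mul0r.
Qed.

Lemma slope_param : slope e 0 1.
Proof.
apply: (cvg_trans _ (@cstc 1)); apply: near_eq_cvg.
by near=> i; rewrite subr0 divff//; near: i.
Unshelve. all: by end_near. Qed.

Lemma slopeD f f0 a g g0 b : slope f f0 a -> slope g g0 b ->
  slope (fun i => f i + g i) (f0 + g0) (a + b).
Proof.
move=> fa gb; pose proof (cvgD fa gb) as lim; apply: eq_lim lim => i;
  rewrite !fctE /=; rewrite -mulrDl; congr (_ / _); ring.
Qed.

Lemma slopeM f f0 a g g0 b : slope f f0 a -> slope g g0 b ->
  slope (fun i => f i * g i) (f0 * g0) (a * g0 + f0 * b).
Proof.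
move=> fa gb.
pose proof (cvgD (cvgM fa (slope_cvg gb)) (cvgM (@cstc f0) gb)) as lim.
apply: eq_lim lim => i; rewrite !fctE /=; ring.
Qed.

Lemma slopeZ c f f0 a : slope f f0 a -> slope (fun i => c * f i) (c * f0) (c * a).
Proof. by move=> fa; have := slopeM (slope_cst c) fa; rewrite mul0r add0r. Qed.

Lemma slopeV f f0 a : f0 != 0 -> slope f f0 a ->
  slope (fun i => (f i)^-1) f0^-1 (- a / f0 ^+ 2).
Proof.
move=> f00 fa; have fc := slope_cvg fa.
pose proof (cvgM (cvgN fa) (cvgV (mulf_neq0 f00 f00) (cvgM fc (@cstc f0)))) as lim.
rewrite -expr2 in lim; apply: (cvg_trans _ lim); apply: near_eq_cvg.
have fN0 : \forall i \near F, f i != 0 by exact: (cvgr_neq0 _ fc).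
near=> i; rewrite ?fctE /=.
have fi0 : f i != 0 by near: i.
have ei0 : e i != 0 by near: i.
by field; rewrite fi0 ei0 f00.
Unshelve. all: by end_near. Qed.

(** The difference of the squares is divided by f i + f0, so that continuity
    of the chosen branch is all that is asked from a square root. *)
Lemma slope_sqrt (f : I -> K) (f0 a : K) : f0 != 0 -> f @ F --> f0 ->
  slope (fun i => f i ^+ 2) (f0 ^+ 2) a -> slope f f0 (a / (2 * f0)).
Proof.
move=> f00 fc fa.
have s0 : f0 + f0 != 0 by rewrite -mulr2n mulrn_eq0.
pose proof (cvgD fc (@cstc f0)) as sc.
pose proof (cvgM fa (cvgV s0 sc)) as lim.
rewrite (_ : f0 + f0 = 2 * f0) in lim; last by ring.
apply: (cvg_trans _ lim); apply: near_eq_cvg.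
have sN0 : \forall i \near F, f i + f0 != 0 by exact: (cvgr_neq0 _ sc).
near=> i; rewrite ?fctE /=.
have fi0 : f i + f0 != 0 by near: i.
have ei0 : e i != 0 by near: i.
by field; rewrite fi0 ei0.
Unshelve. all: by end_near. Qed.

Lemma slope_near f g f0 a : (\forall i \near F, f i = g i) ->
  slope f f0 a -> slope g f0 a.
Proof.
move=> fg lim; apply: (cvg_trans _ lim); apply: near_eq_cvg.
near=> i; congr ((_ - _) / _); near: i; by apply: filterS fg => i ->.
Unshelve. all: by end_near. Qed.

(** Used where two formulas for a function meet: if both have the same slope
    there, a choice between them at each point does not affect the limit. *)
Lemma slope_pick f g h f0 a : slope f f0 a -> slope g f0 a ->
  (forall i, h i = f i \/ h i = g i) -> slope h f0 a.
Proof.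
move=> fa ga hfg; apply/cvgrPdist_lt => eps eps0.
move/cvgrPdist_lt : fa => /(_ _ eps0) fa; move/cvgrPdist_lt : ga => /(_ _ eps0) ga.
near=> i; case: (hfg i) => ->; near: i; [exact: fa|exact: ga].
Unshelve. all: by end_near. Qed.
End slope_calculus.

Section has_slope.
Variables (I : Type) (K : numFieldType) (F : set_system I).
Context {FF : Filter F}.
Variable e : I -> K.
Hypotheses (e0 : e @ F --> 0) (eN0 : \forall i \near F, e i != 0).

(** Differentiability without the value of the derivative, which is what
    holomorphy of the flow map amounts to. *)
Definition has_slope (f : I -> K) (f0 : K) := exists a, slope F e f f0 a.

Lemma has_slope_cvg f f0 : has_slope f f0 -> f @ F --> f0.
Proof. by move=> [a]; exact: slope_cvg. Qed.

Lemma has_slope_vertical c z :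
  has_slope (fun i => (e i + z) ^+ 2 - c) (z ^+ 2 - c).
Proof.
have S : slope F e (fun i => e i + z) (0 + z) (1 + 0).
  by apply: slopeD; [exact: slope_param|exact: slope_cst].
rewrite add0r in S; eexists.
by apply: slopeD; [exact: (slopeM e0 eN0 S S)|exact: slope_cst].
Qed.

Lemma has_slope_sqrt (f : I -> K) f0 : f0 != 0 -> f @ F --> f0 ->
  has_slope (fun i => f i ^+ 2) (f0 ^+ 2) -> has_slope f f0.
Proof. by move=> ? ? [a ?]; eexists; apply: slope_sqrt; eauto. Qed.

Lemma has_slope_chart (f : I -> K) f0 c : f0 + c != 0 -> has_slope f f0 ->
  has_slope (fun i => (f i + c + c) ^+ 2 / (f i + c)) ((f0 + c + c) ^+ 2 / (f0 + c)).
Proof.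
move=> f00 [a S].
pose proof (slopeD S (@slope_cst _ _ F _ e c)) as S1;
  pose proof (slopeD S1 (@slope_cst _ _ F _ e c)) as S2.
eexists; exact: (slopeM e0 eN0 (slopeM e0 eN0 S2 S2) (slopeV e0 eN0 f00 S1)).
Qed.

Lemma has_slope_discr (f : I -> K) f0 c : has_slope f f0 ->
  has_slope (fun i => f i * (f i - c)) (f0 * (f0 - c)).
Proof.
move=> [a S]; eexists.
exact: (slopeM e0 eN0 S (slopeD S (@slope_cst _ _ F _ e (- c)))).
Qed.

Lemma has_slope_mean (f g : I -> K) f0 g0 c : has_slope f f0 -> has_slope g g0 ->
  has_slope (fun i => (f i + g i) / 2 + c) ((f0 + g0) / 2 + c).
Proof.
move=> [a S] [b S']; eexists.
exact: (slopeD (slopeM e0 eN0 (slopeD S S') (@slope_cst _ _ F _ e 2^-1)) (@slope_cst _ _ F _ e c)).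
Qed.
End has_slope.

Lemma cvg_affine (K : numFieldType) (I : Type) (F : set_system I) (FF : Filter F)
    (f : I -> K) (c d l : K) :
  f @ F --> l -> (fun i => c - d * f i) @ F --> c - d * l.
Proof.
move=> fl; apply: cvgB; first exact: cvg_cst.
by apply: cvgM => //; exact: cvg_cst.
Qed.

Lemma cvg_subc (K : numFieldType) (I : Type) (F : set_system I) (FF : Filter F)
    (f : I -> K) (c l : K) : f @ F --> l -> (fun i => f i - c) @ F --> l - c.
Proof. by move=> fl; apply: cvgB => //; exact: cvg_cst. Qed.

Lemma cvg_chart (K : numFieldType) (I : Type) (F : set_system I) (FF : Filter F)
    (f : I -> K) (c l : K) : l != 0 ->
  f @ F --> l -> (fun i => (f i + c) ^+ 2 / f i) @ F --> (l + c) ^+ 2 / l.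
Proof.
move=> l0 fl; have flc : (fun i => f i + c) @ F --> l + c.
  by apply: cvgD => //; exact: cvg_cst.
by apply: cvgM; [exact: cvgM|exact: cvgV].
Qed.

(** * Slit and arc phases of the flow *)

Lemma within_dnbhs_sub (T : topologicalType) (D : set T) (t : T) :
  within D t^' `=>` nbhs t.
Proof.
move=> A At; rewrite /nbhs /= /within /=; rewrite /dnbhs /within /=.
by apply: filterS At.
Qed.

Section driver.
Variable R : realType.
Implicit Types rho s t : R.

(** The circle carrying the arc traced after time s has this radius at time t.
    Without a truncation at s, it is differentiable on both sides of s. *)
Definition radius rho s t := Num.sqrt (rho ^+ 2 + 2 * (t - s)).

(** After time s this is, up to translations of time and space, the driver
    3 sqrt 2 sqrt t, whose hulls are arcs of half circles. *)
Definition driver rho s t := 3 * (radius rho s (Num.max s t) - rho).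

Lemma radius_start rho s : 0 < rho -> radius rho s s = rho.
Proof. by move=> ?; rewrite /radius subrr mulr0 addr0 sqrtr_sqr gtr0_norm. Qed.

Lemma driver_before rho s t : 0 < rho -> t <= s -> driver rho s t = 0.
Proof. by move=> ? ts; rewrite /driver max_l// radius_start// subrr mulr0. Qed.

Lemma driver_after rho s t : s <= t -> driver rho s t = 3 * (radius rho s t - rho).
Proof. by move=> ts; rewrite /driver max_r. Qed.

Lemma sqr_radius rho s t : 0 < rho -> s <= t ->
  radius rho s t ^+ 2 = rho ^+ 2 + 2 * (t - s).
Proof. by move=> r0 st; rewrite sqr_sqrtr// addr_ge0 ?sqr_ge0// mulr_ge0// subr_ge0. Qed.

Lemma radius_gt0 rho s t : 0 < rho -> s <= t -> 0 < radius rho s t.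
Proof.
by move=> r0 st; rewrite sqrtr_gt0 ltr_wpDr ?exprn_gt0// mulr_ge0// subr_ge0.
Qed.

Lemma radius_mono rho s t t' : t <= t' -> radius rho s t <= radius rho s t'.
Proof. by move=> tt; rewrite ler_wsqrtr// lerD2l ler_pM2l// lerD2r. Qed.

Lemma continuous_radius rho s : continuous (radius rho s).
Proof.
move=> t; apply: (@continuous_comp _ _ _ (fun t => rho ^+ 2 + 2 * (t - s)) Num.sqrt);
  last exact: sqrt_continuous.
apply: cvgD; first exact: cvg_cst.
apply: cvgM; first exact: cvg_cst.
by apply: cvgB; [exact: cvg_id|exact: cvg_cst].
Qed.

Lemma continuous_driver rho s : continuous (driver rho s).
Proof.
move=> t; apply: cvgM; first exact: cvg_cst.
apply: cvgB; last exact: cvg_cst.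
apply: (@continuous_comp _ _ _ (Num.max s) (radius rho s));
  last exact: continuous_radius.
apply: (@continuous_max _ _ (fun=> s) id t); [exact: cvg_cst|exact: cvg_id].
Qed.
End driver.

Section flow.
Variables (R : realType) (K : numFieldType) (iota : {rmorphism R -> K}).
Hypothesis iota_cont : forall a : R, iota x @[x --> a] --> iota a.

Section slopes.
Variables (D : set R) (t : R).
Let F := within D t^'.
Let e s := iota (s - t).

Lemma increment_cvg0 : e s @[s --> F] --> 0.
Proof.
rewrite -(rmorph0 iota); apply: (@cvg_trans _ ((iota \o (fun s => s - t)) @ nbhs t)).
  by apply: cvg_app; exact: within_dnbhs_sub.
apply: cvg_comp; last exact: iota_cont.
rewrite -(subrr t); apply: cvgB; [exact: cvg_id|exact: cvg_cst].
Qed.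

Lemma increment_neq0 : \forall s \near F, e s != 0.
Proof.
change (nbhs t (fun s => s != t -> D s -> e s != 0)).
by apply: filterE => s st _; rewrite fmorph_eq0 subr_eq0.
Qed.

Let e0 := increment_cvg0.
Let eN0 := increment_neq0.

Lemma slope_iota (f : R -> R) f0 a : slope F (fun s => s - t) f f0 a ->
  slope F e (iota \o f) (iota f0) (iota a).
Proof.
move=> fa; rewrite /slope.
have -> : (fun i => ((iota \o f) i - iota f0) / e i) =
    iota \o (fun s => (f s - f0) / (s - t)).
  by apply/funext => s /=; rewrite /e fmorph_div !rmorphB.
exact: (cvg_comp _ _ fa (@iota_cont a)).
Qed.

(** From h^2 = z^2 - 4 t one gets 2 h h' = - 4. *)
Lemma slope_vertical (z : K) (sigma : R -> K) :
  (\forall s \near t, sigma s ^+ 2 = z ^+ 2 - 4 * iota s) ->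
  sigma @ F --> sigma t -> sigma t != 0 ->
  slope F e sigma (sigma t) (- 2 / sigma t).
Proof.
move=> sq sc s0.
have -> : - 2 / sigma t = - 4 / (2 * sigma t) by field.
apply: slope_sqrt => //; rewrite (nbhs_singleton sq).
have H : slope F e (fun s => z ^+ 2 - 4 * iota t + - 4 * iota (s - t))
    (z ^+ 2 - 4 * iota t + - 4 * 0) (0 + - 4 * 1).
  apply: slopeD; first exact: slope_cst.
  by apply: slopeZ => //; exact: slope_param.
move: H; rewrite add0r mulr1 mulr0 addr0; apply: slope_near.
by apply: (@within_dnbhs_sub _ D t); apply: filterS sq => s ->; rewrite rmorphB; ring.
Qed.

(** With k = h + c - 2 r and sigma = k - r^2 / k the hypothesis on sigma says that
    k^2 - (Q - 2 r) k + r^2 = 0, i.e. that (k + r)^2 / k keeps the value Q.  Since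
    r' = 1 / r, differentiating h gives (sigma - Q) / (r sigma), which equals
    - 2 / (k - r) by this relation. *)
Lemma slope_arc (Q c : K) (r : R -> R) (sigma : R -> K) :
  0 < r t -> slope F (fun s => s - t) r (r t) (r t)^-1 ->
  (\forall s \near t, sigma s ^+ 2 = Q * (Q - 4 * iota (r s))) ->
  sigma @ F --> sigma t -> sigma t != 0 ->
  let h s := (Q + sigma s) / 2 + iota (r s) - c in
  h t != 3 * iota (r t) - c /\
  slope F e h (h t) (- 2 / (h t - (3 * iota (r t) - c))).
Proof.
move=> r0 rslope sqn sc s0 h; have sq := nbhs_singleton sqn.
have ir0 : iota (r t) != 0 by rewrite fmorph_eq0 gt_eqF.
have Q4 : Q * (Q - 4 * iota (r t)) != 0 by rewrite -sq sqrf_eq0.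
have := Q4; rewrite mulf_eq0 negb_or => /andP[Q0 Qr0].
have hE : h t - (3 * iota (r t) - c) = (Q + sigma t) / 2 - 2 * iota (r t).
  by rewrite /h; field.
have d0 : (Q + sigma t) / 2 - 2 * iota (r t) != 0.
  apply/eqP => d0; move: Qr0; apply/negP; rewrite negbK.
  have sE : sigma t = 4 * iota (r t) - Q.
    apply/eqP; rewrite -subr_eq0; apply/eqP.
    transitivity (2 * ((Q + sigma t) / 2 - 2 * iota (r t))); first by field.
    by rewrite d0 mulr0.
  have := sq; rewrite sE => /eqP; rewrite -subr_eq0.
  have -> : (4 * iota (r t) - Q) ^+ 2 - Q * (Q - 4 * iota (r t)) =
     (- 4 * iota (r t)) * (Q - 4 * iota (r t)) by ring.
  by rewrite mulf_eq0 mulf_eq0 oppr_eq0 pnatr_eq0 (negbTE ir0).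
rewrite hE -subr_eq0 hE; split => //.
have irs := slope_iota rslope.
have s2 : slope F e (fun s => sigma s ^+ 2) (sigma t ^+ 2)
    (Q * (- 4 * iota (r t)^-1)).
  have H : slope F e (fun s => Q * (Q + - 4 * iota (r s)))
     (Q * (Q + - 4 * iota (r t))) (Q * (0 + - 4 * iota (r t)^-1)).
    apply: slopeZ => //; apply: slopeD; first exact: slope_cst.
    exact: slopeZ.
  move: H; rewrite add0r sq mulNr; apply: slope_near.
  by apply: (@within_dnbhs_sub _ D t); apply: filterS sqn => s ->; rewrite mulNr.
have H : slope F e (fun s => 2^-1 * (Q + sigma s) + iota (r s) + - c)
   (2^-1 * (Q + sigma t) + iota (r t) + - c)
   (2^-1 * (0 + Q * (- 4 * iota (r t)^-1) / (2 * sigma t)) + iota (r t)^-1 + 0).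
  apply: slopeD; last exact: slope_cst.
  apply: slopeD; last exact: irs.
  apply: slopeZ => //; apply: slopeD; first exact: slope_cst.
  exact: slope_sqrt.
have -> : - 2 / ((Q + sigma t) / 2 - 2 * iota (r t)) =
  2^-1 * (0 + Q * (- 4 * iota (r t)^-1) / (2 * sigma t)) + iota (r t)^-1 + 0.
  rewrite fmorphV; set S := sigma t in s0 d0 *; set p := iota (r t) in ir0 d0 *.
  have -> : 2^-1 * (0 + Q * (- 4 * p^-1) / (2 * S)) + p^-1 + 0 = (S - Q) / (p * S).
    by field; rewrite ir0 s0.
  apply/eqP; rewrite eqr_div ?mulf_neq0//; apply/eqP.
  have -> : (S - Q) * ((Q + S) / 2 - 2 * p) =
      (S ^+ 2 - Q ^+ 2) / 2 - 2 * p * (S - Q) by field.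
  by rewrite /S sq -/p; field.
have -> : h t = 2^-1 * (Q + sigma t) + iota (r t) - c by rewrite /h mulrC.
by move: H; apply: slope_near; apply: nearW => s; rewrite /h /= mulrC.
Qed.
End slopes.

End flow.

Lemma slope_radius (R : realType) (D : set R) (rho s t : R) : 0 < rho -> s <= t ->
  slope (within D t^') (fun u => u - t) (radius rho s) (radius rho s t)
    (radius rho s t)^-1.
Proof.
move=> rho0 st; have r0 := radius_gt0 rho0 st.
have idc : forall a : R, idfun x @[x --> a] --> (idfun a : R) by move=> a;
  exact: cvg_id.
have e0 := increment_cvg0 idc D t; have eN0 := increment_neq0 idfun D t.
have -> : (radius rho s t)^-1 = 2 / (2 * radius rho s t) by field; rewrite gt_eqF.
apply: slope_sqrt => //; first by rewrite gt_eqF.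
  apply: cvg_trans (@continuous_radius _ rho s t); apply: cvg_app.
  exact: within_dnbhs_sub.
have H : slope (within D t^') (fun u => u - t)
  (fun u => (rho ^+ 2 + 2 * (t - s)) + 2 * (u - t))
  ((rho ^+ 2 + 2 * (t - s)) + 2 * 0) (0 + 2 * 1).
  apply: slopeD; first exact: slope_cst.
  by apply: slopeZ => //; exact: slope_param.
rewrite sqr_radius//; move: H; rewrite add0r mulr1 mulr0 addr0.
apply: slope_near; apply: (@within_dnbhs_sub _ D t).
near=> u; rewrite sqr_sqrtr; first by ring.
have : s - rho ^+ 2 / 2 < u.
  near: u; apply: lt_nbhsr; have : 0 < rho ^+ 2 by rewrite exprn_gt0.
  by move: st; lra.
lra.
Unshelve. all: by end_near. Qed.

Section solution.
Variables (R : realType) (K : numFieldType) (iota : {rmorphism R -> K}).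
Hypothesis iota_cont : forall a : R, iota x @[x --> a] --> iota a.
Variables (rho s : R).
Hypotheses (rho0 : 0 < rho).

(** The two formulas have the same value at s, hence by the equation the same
    derivative there. *)
Lemma solution_glue (D : set R) (z Q : K) (sigma1 sigma2 : R -> K) : 0 <= s ->
  sigma1 0 = z ->
  (forall t, D t -> t <= s ->
    [/\ \forall u \near t, sigma1 u ^+ 2 = z ^+ 2 - 4 * iota u,
        sigma1 @ t --> sigma1 t & sigma1 t != 0]) ->
  (forall t, D t -> s <= t ->
    [/\ \forall u \near t, sigma2 u ^+ 2 = Q * (Q - 4 * iota (radius rho s u)),
        sigma2 @ t --> sigma2 t & sigma2 t != 0]) ->
  (D s -> sigma1 s = (Q + sigma2 s) / 2 - 2 * iota rho) ->
  loewner_solution iota D (driver rho s) z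
    (fun t => if t <= s then sigma1 t
              else (Q + sigma2 t) / 2 + iota (radius rho s t) - 3 * iota rho).
Proof.
move=> s0 z1 c1 c2 match_s; split; first by rewrite s0.
set h := fun t => if t <= s then sigma1 t
  else (Q + sigma2 t) / 2 + iota (radius rho s t) - 3 * iota rho.
set h2 := fun t => (Q + sigma2 t) / 2 + iota (radius rho s t) - 3 * iota rho.
move=> t Dt.
have slope1 : t <= s -> sigma1 t != iota (driver rho s t) /\
    slope (within D t^') (fun s => iota (s - t)) sigma1 (sigma1 t)
      (- 2 / (sigma1 t - iota (driver rho s t))).
  move=> ts; have [sq1 c10 s10] := c1 _ Dt ts.
  rewrite driver_before// rmorph0 subr0; split => //.
  apply: (slope_vertical _ sq1) => //.
  by apply: cvg_trans c10; apply: cvg_app; exact: within_dnbhs_sub.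
have slope2 : s <= t -> h2 t != iota (driver rho s t) /\
    slope (within D t^') (fun s => iota (s - t)) h2 (h2 t)
      (- 2 / (h2 t - iota (driver rho s t))).
  move=> st; have [sq2 c20 s20] := c2 _ Dt st.
  have -> : iota (driver rho s t) = 3 * iota (radius rho s t) - 3 * iota rho.
    by rewrite driver_after// rmorphM rmorphB mulrBr rmorph_nat.
  apply: (slope_arc _ _ _ _ sq2) => //; first exact: radius_gt0.
    exact: slope_radius.
  by apply: cvg_trans c20; apply: cvg_app; exact: within_dnbhs_sub.
have [ts|ts|tse] := ltgtP t s.
- have [? Hs] := slope1 (ltW ts); split => //.
  apply: slope_near Hs; apply: (@within_dnbhs_sub _ D t).
  by near=> u; rewrite /h ltW//; near: u; exact: lt_nbhsl.
- have [? Hs] := slope2 (ltW ts); split => //.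
  apply: slope_near Hs; apply: (@within_dnbhs_sub _ D t).
  by near=> u; rewrite /h leNgt ifN ?negbK//; near: u; exact: lt_nbhsr.
- move: tse Dt slope1 slope2 => -> Dt slope1 slope2.
  have h2s : h2 s = sigma1 s.
    by rewrite match_s// /h2 radius_start//; ring.
  have [? H1] := slope1 (lexx _); have [_ H2] := slope2 (lexx _).
  split => //; rewrite h2s in H2.
  by apply: slope_pick H1 H2 _ => u; rewrite /h; case: ifP => _; [left|right].
Unshelve. all: by end_near. Qed.
End solution.

(** * The complex square root with values in the closed upper half plane *)

Local Open Scope complex_scope.
(* The numeric field R[i]: in this guise it carries the topology of its norm. *)
Local Notation numC R := (R[i] : numFieldType).

Section complex_sqrt.
Variable R : realType.
Implicit Types z w : R[i].

Lemma ImD z w : complex.Im (z + w) = complex.Im z + complex.Im w.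
Proof. by case: z w => [? ?] [? ?]. Qed.

Lemma ImDr z (a : R) : complex.Im (z + a%:C) = complex.Im z.
Proof. by rewrite ImD addr0. Qed.

Lemma Im_le_norm z : (complex.Im z)%:C <= `|z|.
Proof.
rewrite normc_def lecR; apply: le_trans (ler_norm _) _.
by rewrite -sqrtr_sqr ler_wsqrtr// lerDr sqr_ge0.
Qed.

Lemma continuous_real_complex (a : R) :
  (x%:C : numC R) @[x --> a] --> (a%:C : numC R).
Proof.
apply/cvgrPdist_lt => eps; case: eps => e e'; rewrite ltcE /= => /andP[/eqP -> e0].
have := @cvg_id R (nbhs a) _ => /cvgrPdist_lt /(_ _ e0) H.
near=> x; rewrite -rmorphB normc_def /= expr0n /= addr0 sqrtr_sqr ltcR.
by near: x.
Unshelve. all: by end_near. Qed.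

Lemma Im_sqrtC_ge0 z : 0 <= complex.Im (sqrtC z).
Proof. by rewrite -lecR complexIm; exact: Im_rootC_ge0. Qed.

Lemma Im_sqrtC_gt0 z : ~~ (0 <= z) -> 0 < complex.Im (sqrtC z).
Proof.
move=> z0; rewrite lt_neqAle Im_sqrtC_ge0 andbT; apply: contra z0 => /eqP.
rewrite -{2}(sqrtCK z); case: (sqrtC z) => a b /= <-.
by rewrite expr2; simpc; rewrite /= -expr2 sqr_ge0.
Qed.

Lemma sqr_nonneg_real z : 0 <= z ^+ 2 -> complex.Im z = 0.
Proof.
case: z => a b; rewrite expr2 lecE /=; simpc => /= /andP[/eqP h1 h2].
apply/eqP; move: h1 h2; rewrite mulrC -mulr2n => /eqP.
rewrite mulrn_eq0 /= mulf_eq0 => /orP[//|/eqP ->].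
rewrite mul0r sub0r oppr_ge0 -expr2 => h; rewrite -sqrf_eq0 eq_le h.
exact: sqr_ge0.
Qed.

Lemma sqr_upper_nonneg z : 0 < complex.Im z -> ~~ (0 <= z ^+ 2).
Proof. by move=> z0; apply/negP => /sqr_nonneg_real zE; rewrite zE ltxx in z0. Qed.

Lemma sqrtC_sqr_upper z : 0 < complex.Im z -> sqrtC (z ^+ 2) = z.
Proof.
move=> z0; have /eqP := sqrtCK (z ^+ 2); rewrite eqf_sqr => /orP[/eqP//|/eqP E].
have := Im_sqrtC_ge0 (z ^+ 2); rewrite E; case: z z0 {E} => a b /=.
by rewrite oppr_ge0 => b0 /(lt_le_trans b0); rewrite ltxx.
Qed.

(** Both roots have a nonnegative imaginary part, so that the modulus of their
    sum, which divides the difference of the squares, is at least the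
    imaginary part of the limit.  The latter is positive except at 0, where
    the squared modulus of the root is the modulus of the argument. *)
Lemma cvg_sqrtC (I : Type) (F : set_system I) (FF : Filter F) (f : I -> numC R)
    (z : numC R) : ~~ (0 < z) -> f @ F --> z ->
  (fun i => sqrtC (f i) : numC R) @ F --> (sqrtC z : numC R).
Proof.
move=> z0 /cvgrPdist_lt fz; apply/cvgrPdist_lt => e e0.
have [zE|zN0] := eqVneq z 0.
  have e20 : 0 < e ^+ 2 by rewrite exprn_gt0.
  rewrite zE sqrtC0; near=> i; rewrite sub0r normrN.
  rewrite -(@ltr_pXn2r _ 2%N) ?nnegrE ?(ltW e0)// -normrX sqrtCK.
  by rewrite -normrN -(sub0r (f i)) -zE; near: i; exact: fz.
have m0 : 0 < (complex.Im (sqrtC z))%:C.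
  by rewrite ltcR; apply: Im_sqrtC_gt0; rewrite le_eqVlt eq_sym negb_or zN0.
near=> i; rewrite -(ltr_pM2r m0).
apply: (@le_lt_trans _ _ `|z - f i|); last first.
  by near: i; apply: fz; exact: mulr_gt0.
rewrite -[X in _ <= `|X - _|]sqrtCK -[X in _ <= `|_ - X|]sqrtCK subr_sqr normrM ler_wpM2l//.
apply: le_trans (Im_le_norm _); rewrite lecR ImD lerDl; exact: Im_sqrtC_ge0.
Unshelve. all: by end_near. Qed.
End complex_sqrt.

(** * The label that linearises the arc phase *)

Section chart.
Variable R : realType.
Implicit Types (k Q z w : R[i]) (r rho s : R).

(** The label of the position k with respect to an arc of radius r; up to the
    translation by 2 r this is the Joukowsky map k + r^2 / k. *)
Definition arc_chart r k : R[i] := (k + r%:C) ^+ 2 / k.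

(** A root of k^2 - (Q - 2 r) k + r^2 = 0, and the one in the upper half plane as
    soon as the discriminant Q (Q - 4 r) is not a nonnegative real. *)
Definition arc_inverse r Q : R[i] := (Q - 2 * r%:C + sqrtC (Q * (Q - 4 * r%:C))) / 2.

Lemma ImZ (a : R) z : complex.Im (a%:C * z) = a * complex.Im z.
Proof. by case: z => x y; simpc. Qed.

Lemma ImV_sign k : 0 < complex.Im k -> complex.Im k^-1 < 0.
Proof.
case: k => a b /= b0; rewrite oppr_lt0 divr_gt0//.
by rewrite ltr_wpDl ?sqr_ge0// exprn_gt0.
Qed.

Lemma ImV_sign_le k : complex.Im k <= 0 -> 0 <= complex.Im k^-1.
Proof.
case: k => a b /= b0; rewrite -mulNr divr_ge0 ?oppr_ge0//.
by rewrite addr_ge0 ?sqr_ge0.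
Qed.

Lemma upper_neq0 k : 0 < complex.Im k -> k != 0.
Proof. by apply: contraTneq => ->; rewrite ltxx. Qed.

Lemma arc_chart_discr r k : k != 0 ->
  arc_chart r k * (arc_chart r k - 4 * r%:C) = (k - r%:C ^+ 2 / k) ^+ 2.
Proof. by move=> k0; rewrite /arc_chart; field. Qed.

Lemma Im_joukowsky r k : 0 < complex.Im k -> 0 < complex.Im (k - r%:C ^+ 2 / k).
Proof.
move=> k0; rewrite -mulNr -rmorphXn -rmorphN ImD ImZ.
rewrite ltr_wpDr// mulr_le0 ?oppr_le0 ?sqr_ge0// ltW//; exact: ImV_sign.
Qed.

(** In the order of the complex numbers 0 <= w means that w is real and
    nonnegative; for w = Q (Q - 4 r) and r > 0 this says that Q lies on one of
    the rays (-oo, 0] and [4 r, oo).  Here w is the square of k - r^2 / k, which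
    has a positive imaginary part. *)
Lemma arc_chart_upper r k : 0 < complex.Im k ->
  ~~ (0 <= arc_chart r k * (arc_chart r k - 4 * r%:C)).
Proof.
move=> k0; rewrite arc_chart_discr ?upper_neq0//.
by apply: sqr_upper_nonneg; exact: Im_joukowsky.
Qed.

Lemma arc_chartK r k : 0 < complex.Im k -> arc_inverse r (arc_chart r k) = k.
Proof.
move=> k0; rewrite /arc_inverse arc_chart_discr ?upper_neq0//.
rewrite sqrtC_sqr_upper ?Im_joukowsky//.
by rewrite /arc_chart; field; exact: upper_neq0.
Qed.

Lemma arc_inverse_quadratic r Q : let k := arc_inverse r Q in
  k * (k - sqrtC (Q * (Q - 4 * r%:C))) = r%:C ^+ 2 /\
  (k + r%:C) ^+ 2 = Q * k.
Proof.
rewrite /arc_inverse; set S := sqrtC _.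
have S2 : S ^+ 2 = Q * (Q - 4 * r%:C) by rewrite sqrtCK.
split.
  have -> : (Q - 2 * r%:C + S) / 2 * ((Q - 2 * r%:C + S) / 2 - S)
     = ((Q - 2 * r%:C) ^+ 2 - S ^+ 2) / 4 by field.
  by rewrite S2; field.
apply/eqP; rewrite -subr_eq0; apply/eqP.
transitivity ((S ^+ 2 - Q * (Q - 4 * r%:C)) / 4); first by field.
by rewrite S2 subrr mul0r.
Qed.

Lemma arc_inverse_neq0 r Q : 0 < r -> arc_inverse r Q != 0.
Proof.
move=> r0; have [h _] := arc_inverse_quadratic r Q.
apply: contraTneq r0 => k0; move: h; rewrite k0 mul0r => /esym/eqP.
by rewrite sqrf_eq0 fmorph_eq0 => /eqP ->; rewrite ltxx.
Qed.

Lemma arc_inverseK r Q : 0 < r -> arc_chart r (arc_inverse r Q) = Q.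
Proof.
move=> r0; rewrite /arc_chart; have [_ ->] := arc_inverse_quadratic r Q.
by rewrite mulfK ?arc_inverse_neq0.
Qed.

(** With S the root of the discriminant, S = k - r^2 / k; if k were in the closed
    lower half plane then so would be S. *)
Lemma arc_inverse_upper r Q : 0 < r -> ~~ (0 <= Q * (Q - 4 * r%:C)) ->
  0 < complex.Im (arc_inverse r Q).
Proof.
move=> r0 /Im_sqrtC_gt0; set S := sqrtC _ => S0.
have [h _] := arc_inverse_quadratic r Q; rewrite -/S in h.
have k0 := arc_inverse_neq0 Q r0.
rewrite ltNge; apply/negP => kle.
have SE : S = arc_inverse r Q - r%:C ^+ 2 / arc_inverse r Q.
  by rewrite -h; field.
move: S0; rewrite SE -mulNr -rmorphXn -rmorphN ImD ImZ mulNr ltNge.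
by rewrite subr_le0 (le_trans kle)// mulr_ge0 ?sqr_ge0// ImV_sign_le.
Qed.

Lemma real_discr r (q : R) : (0 <= q%:C * (q%:C - 4 * r%:C)) = (0 <= q * (q - 4 * r)).
Proof.
by rewrite -(rmorph_nat (real_complex R) 4) -rmorphM -rmorphB -rmorphM lecR.
Qed.

(** Adding 4 r^2 gives (Q - 2 r)^2, and a number whose square is nonnegative
    is real. *)
Lemma discr_nonneg r Q : 0 <= Q * (Q - 4 * r%:C) ->
  exists2 q : R, Q = q%:C & 0 <= q * (q - 4 * r).
Proof.
move=> Q0; have : 0 <= (Q - (2 * r)%:C) ^+ 2.
  have -> : (Q - (2 * r)%:C) ^+ 2 = Q * (Q - 4 * r%:C) + 4 * r%:C ^+ 2.
    by rewrite rmorphM rmorph_nat; ring.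
  by rewrite addr_ge0// mulr_ge0// -rmorphXn lecR sqr_ge0.
move/sqr_nonneg_real; rewrite -rmorphN ImDr => ImQ.
have QE : Q = (complex.Re Q)%:C by case: Q ImQ {Q0} => a b /= ->.
exists (complex.Re Q) => //; move: Q0; rewrite QE /=.
by rewrite real_discr.
Qed.

(** The excluded ray [4 r, oo) shrinks when r grows. *)
Lemma discr_grow rho r Q : 0 <= rho <= r -> ~~ (0 <= Q * (Q - 4 * rho%:C)) ->
  ~~ (0 <= Q * (Q - 4 * r%:C)).
Proof.
move=> /andP[rho0 rr]; apply: contra => /discr_nonneg[q -> qr].
rewrite real_discr; have [q0|q0] := lerP q 0; first by rewrite mulr_le0//; lra.
by rewrite pmulr_rge0// in qr; rewrite mulr_ge0 ?(ltW q0)//; lra.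
Qed.

Lemma vertical_upper s z : 0 <= s -> 0 < complex.Im z ->
  ~~ (0 <= z ^+ 2 - 4 * s%:C).
Proof.
move=> s0 /sqr_upper_nonneg; apply: contra => h.
rewrite -(subrK (4 * s%:C) (z ^+ 2)) addr_ge0// mulr_ge0//.
by rewrite lecR.
Qed.

(** The vertical slit map of the first phase followed by the map of the second
    phase, in which the radius grows from rho to r while labels are kept. *)
Definition slit_map rho r s z : R[i] :=
  arc_inverse r (arc_chart rho (sqrtC (z ^+ 2 - 4 * s%:C) + rho%:C)).
End chart.

(** * The slit map is a bijection onto the complement of a curve *)

Section curve.
Variables (R : realType) (rho r s a : R).
Hypotheses (rho0 : 0 < rho) (rho_r : rho < r) (s0 : 0 < s) (a0 : 0 < a).
Implicit Types (z w : R[i]) (u : R).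

Let r0 : 0 < r := lt_trans rho0 rho_r.

(** Runs from 0 to 2 sqrt s, the height of the slit grown in the first phase,
    for u from a to a + s. *)
Definition slit_height u := 2 / Num.sqrt s * Num.max (u - a) 0.

(** The labels missed by the slit map, from the foot of the curve on the real
    line to its tip: first the real labels from 4 r down to 4 rho, for u <= a,
    and then the labels of the vertical slit.  The truncations make one
    continuous formula out of the two pieces. *)
Definition arc_chart_path u : R[i] :=
  arc_chart rho (rho%:C + 'i * (slit_height u)%:C)
  + (4 * (r - rho) / a * Num.max (a - u) 0)%:C.

Lemma path_arc u : u <= a ->
  arc_chart_path u = (4 * (rho + (r - rho) * ((a - u) / a)))%:C.
Proof.
move=> ua; rewrite /arc_chart_path /slit_height max_r ?subr_le0// max_l ?subr_ge0//.
rewrite mulr0 rmorph0 mulr0 addr0 /arc_chart.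
have -> : (rho%:C + rho%:C) ^+ 2 / rho%:C = (4 * rho)%:C.
  rewrite rmorphM rmorph_nat; field; by rewrite fmorph_eq0 gt_eqF.
by rewrite -rmorphD; congr (_%:C); field; rewrite gt_eqF.
Qed.

Lemma path_slit u : a <= u ->
  arc_chart_path u = arc_chart rho (rho%:C + 'i * (slit_height u)%:C).
Proof.
by move=> au; rewrite /arc_chart_path [Num.max (a - u) 0]max_r ?subr_le0// mulr0 addr0.
Qed.

Lemma slit_height_gt0 u : a < u -> 0 < slit_height u.
Proof.
by move=> au; rewrite /slit_height max_l ?subr_ge0 ?ltW// mulr_gt0 ?divr_gt0 ?sqrtr_gt0 ?subr_gt0.
Qed.

Lemma slit_heightE u : a <= u -> slit_height u = 2 / Num.sqrt s * (u - a).
Proof. by move=> au; rewrite /slit_height max_l// subr_ge0. Qed.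

Lemma sqr_slit_height u : a <= u <= a + s -> slit_height u ^+ 2 <= 4 * s.
Proof.
move=> /andP[au us]; rewrite slit_heightE//.
have q0 : 0 < Num.sqrt s by rewrite sqrtr_gt0.
rewrite exprMn expr_div_n sqr_sqrtr ?(ltW s0)// mulrAC ler_pdivrMr//.
have -> : 2 ^+ 2 * (u - a) ^+ 2 = 4 * (u - a) ^+ 2 by ring.
rewrite -mulrA ler_pM2l// -expr2 ler_pXn2r ?nnegrE//; lra.
Qed.

Lemma Im_tip (v : R) : complex.Im (rho%:C + 'i * v%:C) = v.
Proof. by simpc; rewrite /=; ring. Qed.

(** Labels in [4 rho, 4 r) avoid the rays of radius r, and those of the vertical
    slit avoid even the larger rays of radius rho. *)
Lemma path_upper u : 0 < u ->
  ~~ (0 <= arc_chart_path u * (arc_chart_path u - 4 * r%:C)).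
Proof.
move=> u0; have [ua|au] := leP u a.
  rewrite path_arc// real_discr -mulrBr.
  have k1 : (a - u) / a < 1 by rewrite ltr_pdivrMr// mul1r; lra.
  have k0 : 0 <= (a - u) / a by rewrite divr_ge0 ?subr_ge0// ltW.
  set k := (a - u) / a in k0 k1 *.
  have q0 : 0 < rho + (r - rho) * k.
    by rewrite ltr_pwDl// mulr_ge0// subr_ge0 ltW.
  rewrite -ltNge pmulr_rlt0.
    have : 0 < (r - rho) * (1 - k) by rewrite mulr_gt0 ?subr_gt0.
    by move: rho_r; lra.
  by rewrite mulr_gt0.
rewrite path_slit ?(ltW au)//; apply: (@discr_grow _ rho); first by rewrite !ltW.
by apply: arc_chart_upper; rewrite Im_tip slit_height_gt0.
Qed.

(** This tells the two pieces apart: only the first one lies on the ray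
    [4 rho, oo). *)
Lemma path_arc_lower u : 0 <= u <= a ->
  0 <= arc_chart_path u * (arc_chart_path u - 4 * rho%:C).
Proof.
move=> /andP[u0 ua]; rewrite path_arc// real_discr.
have k0 : 0 <= (r - rho) * ((a - u) / a).
  by rewrite mulr_ge0 ?divr_ge0 ?subr_ge0 ?(ltW rho_r)// ltW.
by rewrite mulr_ge0//; move: rho0 k0; lra.
Qed.

Lemma path_inj : {in `[0, a + s] &, injective arc_chart_path}.
Proof.
have mixed u v : 0 <= u <= a -> a < v -> arc_chart_path u <> arc_chart_path v.
  move=> /path_arc_lower + av E; rewrite E path_slit ?(ltW av)//; apply/negP.
  by apply: arc_chart_upper; rewrite Im_tip slit_height_gt0.
move=> u v; rewrite !in_itv /= => /andP[u0 us] /andP[v0 vs].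
have [ua|au] := leP u a; have [va|av] := leP v a => E.
- move: E; rewrite !path_arc// => /(fmorph_inj (real_complex R)).
  have r1 : r - rho != 0 by rewrite subr_eq0 gt_eqF.
  have a1 : a != 0 by rewrite gt_eqF.
  have n4 : (4 : R) != 0 by rewrite pnatr_eq0.
  move/(mulfI n4)/addrI/(mulfI r1).
  by move/(divIf a1)/addrI/oppr_inj.
- by exfalso; apply: (mixed u v) => //; rewrite u0.
- by exfalso; apply: (mixed v u) => //; rewrite v0.
- move: E; rewrite !path_slit ?ltW// => /(congr1 (arc_inverse rho)).
  rewrite !arc_chartK ?Im_tip ?slit_height_gt0// => /(congr1 (@complex.Im R)).
  rewrite !Im_tip !slit_heightE ?ltW// => /(mulfI _)/addIr; apply.
  by rewrite mulf_neq0// invr_eq0 gt_eqF// sqrtr_gt0.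
Qed.

Let slit_point z : R[i] := sqrtC (z ^+ 2 - 4 * s%:C).

Let slit_point_upper z : 0 < complex.Im z -> 0 < complex.Im (slit_point z).
Proof. by move=> z0; apply/Im_sqrtC_gt0/vertical_upper => //; exact: ltW. Qed.

Lemma slit_map_upper z : 0 < complex.Im z -> 0 < complex.Im (slit_map rho r s z).
Proof.
move=> z0; apply: arc_inverse_upper => //.
apply: (@discr_grow _ rho); first by rewrite !ltW.
by apply: arc_chart_upper; rewrite ImDr slit_point_upper.
Qed.

(** Each of the three maps composed has a left inverse. *)
Lemma slit_map_inj z w : 0 < complex.Im z -> 0 < complex.Im w ->
  slit_map rho r s z = slit_map rho r s w -> z = w.
Proof.
move=> z0 w0 /(congr1 (arc_chart r)); rewrite !arc_inverseK//.
move/(congr1 (arc_inverse rho)); rewrite !arc_chartK ?ImDr ?slit_point_upper//.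
move/addIr/(congr1 (fun x => x ^+ 2)); rewrite !sqrtCK => /addIr.
by move/(congr1 sqrtC); rewrite !sqrtC_sqr_upper.
Qed.

(** A point z of the half plane reaches neither piece: its label with respect to
    rho is not on [4 rho, oo), and z^2 - 4 s = - v^2 with v^2 <= 4 s would make
    z^2 nonnegative. *)
Lemma slit_map_range z u : 0 < complex.Im z -> 0 < u <= a + s ->
  slit_map rho r s z <> arc_inverse r (arc_chart_path u).
Proof.
move=> z0 /andP[u0 us] /(congr1 (arc_chart r)); rewrite !arc_inverseK//.
rewrite -/(slit_point z).
have k0 : 0 < complex.Im (slit_point z + rho%:C) by rewrite ImDr slit_point_upper.
have [ua|au] := leP u a.
  move=> E; have := arc_chart_upper rho k0; rewrite E.
  by rewrite path_arc_lower// ltW.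
rewrite path_slit ?ltW// => /(congr1 (arc_inverse rho)).
rewrite !arc_chartK ?Im_tip ?slit_height_gt0// addrC => /addrI.
move/(congr1 (fun x => x ^+ 2)); rewrite sqrtCK exprMn sqr_i mulN1r => /eqP.
rewrite subr_eq => /eqP zE; have /negP := sqr_upper_nonneg z0; apply.
rewrite zE addrC subr_ge0 -rmorphXn -(rmorph_nat (real_complex R) 4) -rmorphM lecR.
by apply: sqr_slit_height; rewrite ltW.
Qed.

(** The label Q of w either lies on the ray of radius rho but not on that of
    radius r, so in [4 rho, 4 r), or comes from a point x + rho with x in the
    half plane; x is then a value of the vertical slit map unless x^2 + 4 s is
    nonnegative, which puts x on the slit. *)
Lemma slit_map_surj w : 0 < complex.Im w ->
  (forall u, 0 < u <= a + s -> w <> arc_inverse r (arc_chart_path u)) ->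
  exists2 z, 0 < complex.Im z & slit_map rho r s z = w.
Proof.
move=> w0 wN; have := arc_chart_upper r w0; have := arc_chartK r w0.
set Q := arc_chart r w => QK Qr.
have [/discr_nonneg[q qE q0]|Qrho] := boolP (0 <= Q * (Q - 4 * rho%:C)).
  exfalso; move: Qr; rewrite qE real_discr -ltNge => qr.
  have qpos : 0 < q.
    rewrite ltNge; apply/negP => qn; move: qr; apply/negP; rewrite -leNgt.
    by rewrite mulr_le0//; move: r0; lra.
  move: q0 qr; rewrite pmulr_rge0// pmulr_rlt0// => qrho qr.
  have rr : 0 < r - rho by rewrite subr_gt0.
  apply: (wN (a * ((r - q / 4) / (r - rho)))).
    have : (r - q / 4) / (r - rho) <= 1 by rewrite ler_pdivrMr//; lra.
    have : 0 < (r - q / 4) / (r - rho) by rewrite divr_gt0//; lra.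
    set k := (_ / _) => k0 k1; rewrite mulr_gt0//=.
    have : a * k <= a by rewrite ger_pMr.
    by move: s0; lra.
  rewrite path_arc; first rewrite -QK qE; first congr (arc_inverse r _%:C).
    by field; rewrite !gt_eqF.
  by rewrite ger_pMr// ler_pdivrMr//; lra.
have k0 := arc_inverse_upper rho0 Qrho.
set k := arc_inverse rho Q in k0; pose x := k - rho%:C.
have x0 : 0 < complex.Im x by rewrite /x -rmorphN ImDr.
have kx : x + rho%:C = k by rewrite subrK.
have [xs|xs] := boolP (0 <= x ^+ 2 + 4 * s%:C).
  exfalso; have [v [v0 vs xE]] : exists v : R, [/\ 0 < v, v ^+ 2 <= 4 * s & x = 'i * v%:C].
    exists (complex.Im x); move: xs x0; rewrite -(rmorph_nat (real_complex R) 4) -rmorphM.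
    clear; case: x => p q; rewrite expr2; simpc => /= /andP[/eqP h1 h2] q0.
    have p0 : p = 0.
      apply/eqP; have : p * q == 0 by apply/eqP; move: h1; lra.
      by rewrite mulf_eq0 (gt_eqF q0) orbF.
    split => //; first by move: h2; rewrite p0; lra.
    by apply/eqP; rewrite eq_complex /= p0; apply/andP; split; apply/eqP; ring.
  have q0 : 0 < Num.sqrt s by rewrite sqrtr_gt0.
  have u0 : 0 < v * Num.sqrt s / 2 by rewrite divr_gt0// mulr_gt0.
  have au : a <= a + v * Num.sqrt s / 2 by rewrite lerDl ltW.
  apply: (wN (a + v * Num.sqrt s / 2)).
    rewrite addr_gt0//= lerD2l ler_pdivrMr//.
    have v2 : v <= 2 * Num.sqrt s.
      rewrite -(@ler_pXn2r _ 2)// ?nnegrE ?mulr_ge0 ?sqrtr_ge0 ?(ltW v0)//.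
      by rewrite exprMn sqr_sqrtr ?(ltW s0)//; move: vs; lra.
    have : v * Num.sqrt s <= 2 * Num.sqrt s * Num.sqrt s by rewrite ler_pM2r.
    by rewrite -mulrA -expr2 sqr_sqrtr ?(ltW s0)//; lra.
  rewrite path_slit// -QK -(arc_inverseK Q rho0) -/k -kx xE.
  congr (arc_inverse r (arc_chart rho _)).
  rewrite addrC; congr (_ + 'i * _%:C).
  by rewrite slit_heightE//; field; rewrite gt_eqF.
exists (sqrtC (x ^+ 2 + 4 * s%:C)); first exact: Im_sqrtC_gt0.
rewrite /slit_map sqrtCK addrK sqrtC_sqr_upper// kx.
by rewrite arc_inverseK// QK.
Qed.
End curve.

(** * The driver generates a simple curve *)

Section simple_curve.
Variables (R : realType) (rho s T : R).
Hypotheses (rho0 : 0 < rho) (s0 : 0 < s) (sT : s < T).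
Implicit Types (z w : R[i]) (u t : R).

Let r := radius rho s T.

Lemma radius_gt_start : rho < r.
Proof.
rewrite -(radius_start s rho0) ltr_sqrt.
  by rewrite ltrD2l ltr_pM2l// ltrD2r.
by rewrite ltr_wpDr ?exprn_gt0// mulr_ge0// subr_ge0 ltW.
Qed.

Let rho_r := radius_gt_start.
Let r0 : 0 < r := lt_trans rho0 rho_r.

Definition flow_slit t z : R[i] := sqrtC (z ^+ 2 - 4 * t%:C).

(** The value at time s has relative position h + rho, the driver being at 0. *)
Definition flow_label z : R[i] := arc_chart rho (flow_slit s z + rho%:C).

(** The root of the discriminant of the quadratic equation for the relative
    position at time t. *)
Definition flow_disc z t : R[i] :=
  sqrtC (flow_label z * (flow_label z - 4 * (radius rho s t)%:C)).

Definition flow t z : R[i] :=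
  if t <= s then flow_slit t z
  else (flow_label z + flow_disc z t) / 2 + (radius rho s t)%:C - 3 * rho%:C.

Lemma flow_final z : flow T z = slit_map rho r s z + (2 * r - 3 * rho)%:C.
Proof.
rewrite /flow leNgt sT /= /slit_map /arc_inverse rmorphB !rmorphM !rmorph_nat.
rewrite -/(flow_slit s z) -/(flow_label z) -/(flow_disc z T) -/r.
by field.
Qed.

Lemma flow_label_upper t z : s <= t -> 0 < complex.Im z ->
  ~~ (0 <= flow_label z * (flow_label z - 4 * (radius rho s t)%:C)).
Proof.
move=> st z0; apply: (@discr_grow _ rho).
  by rewrite ltW//= -{1}(radius_start s rho0) radius_mono.
apply: arc_chart_upper; rewrite ImDr; apply: Im_sqrtC_gt0.
by apply: vertical_upper => //; exact: ltW.
Qed.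

Lemma sqrtC_neq0 z : ~~ (0 <= z) -> sqrtC z != 0.
Proof. by move=> z0; apply: upper_neq0; exact: Im_sqrtC_gt0. Qed.

Lemma flow_solution : upward_loewner_flow T (driver rho s) flow.
Proof.
move=> z z0; rewrite /upper_half_plane /= in z0.
apply: (@solution_glue R (numC R) (real_complex R) (@continuous_real_complex R)
   rho s rho0 `[0, T] z (flow_label z) (fun t => flow_slit t z) (flow_disc z)).
- exact: ltW.
- by rewrite /flow_slit mulr0 subr0 sqrtC_sqr_upper.
- move=> t; rewrite /= in_itv /= => /andP[t0 tT] ts.
  have tz := vertical_upper t0 z0.
  split; [by apply: (@filterE _ (nbhs t)) => u; exact: sqrtCK| |exact: sqrtC_neq0].
  apply: cvg_sqrtC; first by apply: contra tz; exact: ltW.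
  apply: (@cvg_affine (numC R)); exact: continuous_real_complex.
- move=> t; rewrite /= in_itv /= => /andP[t0 tT] st.
  have tz := flow_label_upper st z0.
  split; [by apply: (@filterE _ (nbhs t)) => u; exact: sqrtCK| |exact: sqrtC_neq0].
  apply: cvg_sqrtC; first by apply: contra tz; exact: ltW.
  apply: (@cvgM (numC R)); first exact: cvg_cst.
  apply: (@cvg_affine (numC R)).
  apply: (cvg_comp (radius rho s) (fun x => x%:C : numC R)).
    exact: continuous_radius.
  exact: continuous_real_complex.
- move=> _; have := vertical_upper (ltW s0) z0 => /Im_sqrtC_gt0 k0.
  rewrite -/(flow_slit s z) in k0.
  have kr : 0 < complex.Im (flow_slit s z + rho%:C) by rewrite ImDr.
  have := arc_chartK rho kr; rewrite /arc_inverse -/(flow_label z).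
  rewrite /flow_disc radius_start// => E.
  by rewrite -(addrK rho%:C (flow_slit s z)) -E; field.
Qed.

(** The translation undoes the change of variable k = h - xi + r at the final
    time. *)
Definition curve u : R[i] :=
  arc_inverse r (arc_chart_path rho r s (T - s) u) + (2 * r - 3 * rho)%:C.

Let a0 : 0 < T - s. Proof. by rewrite subr_gt0. Qed.

Lemma curve_start : curve 0 = (driver rho s T)%:C.
Proof.
rewrite /curve path_arc ?(ltW a0)// subr0 divff ?(gt_eqF a0)// mulr1.
have -> : rho + (r - rho) = r by ring.
rewrite /arc_inverse rmorphM rmorph_nat subrr mulr0 sqrtC0.
rewrite driver_after ?ltW// -/r !rmorphB !rmorphM !rmorph_nat rmorphB; by field.
Qed.

Lemma curve_upper u : 0 < u -> 0 < complex.Im (curve u).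
Proof.
move=> u0; rewrite ImDr; apply: arc_inverse_upper => //.
exact: path_upper.
Qed.

Lemma curve_inj : {in `[0, T] &, injective curve}.
Proof.
move=> u v uT vT /addIr/(congr1 (arc_chart r)); rewrite !arc_inverseK//.
by apply: path_inj; rewrite ?subrK.
Qed.

Lemma flow_derivable z : upper_half_plane z ->
  derivable (flow T : R[i]^o -> R[i]^o) z 1.
Proof.
rewrite /upper_half_plane /= => z0.
have e0 : (fun h : numC R => h) @ (0 : numC R)^' --> (0 : numC R).
  by apply: cvg_within_filter; exact: cvg_id.
have eN0 : \forall h \near (0 : numC R)^', h != 0 by exact: nbhs_dnbhs_neq.
pose sl := @has_slope (R[i]) (numC R) (0 : numC R)^' (fun h => h).
have zs := vertical_upper (ltW s0) z0; have zT := flow_label_upper (ltW sT) z0.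
have S1 : sl (fun h => flow_slit s (h + z)) (flow_slit s z).
  pose proof (has_slope_vertical e0 eN0 (4 * s%:C) z) as Sz.
  apply: (has_slope_sqrt eN0 (f := fun h => flow_slit s (h + z) : numC R)).
  - exact: sqrtC_neq0.
  - apply: cvg_sqrtC; first by apply: contra zs; exact: ltW.
    exact: (has_slope_cvg e0 eN0 Sz).
  - rewrite sqrtCK; move: Sz; congr (has_slope _ _ _ _).
    by apply/funext => h; rewrite sqrtCK.
have S2 : sl (fun h => flow_label (h + z)) (flow_label z).
  apply: (has_slope_chart e0 eN0 _ S1).
  by apply: upper_neq0; rewrite ImDr; exact: Im_sqrtC_gt0.
have S3 : sl (fun h => flow_disc (h + z) T) (flow_disc z T).
  pose proof (has_slope_discr e0 eN0 (4 * r%:C) S2) as SL.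
  apply: (has_slope_sqrt eN0 (f := fun h => flow_disc (h + z) T : numC R)).
  - exact: sqrtC_neq0.
  - apply: cvg_sqrtC; first by apply: contra zT; exact: ltW.
    exact: (has_slope_cvg e0 eN0 SL).
  - rewrite sqrtCK; move: SL; congr (has_slope _ _ _ _).
    by apply/funext => h; rewrite sqrtCK.
pose proof (has_slope_mean e0 eN0 (r%:C - 3 * rho%:C) S2 S3) as [a S4].
apply/cvg_ex; exists a.
have -> : (fun h : R[i] => h^-1 *: ((flow T \o shift z) (h *: (1 : R[i]^o)) - flow T z)) =
  (fun h => ((flow_label (h + z) + flow_disc (h + z) T) / 2 + (r%:C - 3 * rho%:C)
      - ((flow_label z + flow_disc z T) / 2 + (r%:C - 3 * rho%:C))) / h).
  apply/funext => h; rewrite mulrC; congr (_ * _).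
  by rewrite /= /flow leNgt sT /= !addrA [h *: _]mulr1.
exact: S4.
Qed.

Lemma conformal_flow : conformal_onto upper_half_plane
  (upper_half_plane `\` curve @` `]0, T]) (flow T).
Proof.
split; last split.
- exact: flow_derivable.
- move=> z z0; rewrite flow_final; split.
    by rewrite /upper_half_plane /= ImDr; exact: slit_map_upper.
  move=> [u]; rewrite /= in_itv /= => uT /addIr E.
  by apply: (slit_map_range _ _ _ _ z0 _ (esym E)); rewrite ?subrK.
- move=> z w; rewrite !inE => z0 w0; rewrite !flow_final => /addIr.
  exact: slit_map_inj.
- move=> w [w0 wN].
  have w1 : 0 < complex.Im (w - (2 * r - 3 * rho)%:C) by rewrite -rmorphN ImDr.
  have [|z z0 zw] := slit_map_surj rho0 rho_r s0 a0 w1.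
    move=> u uT E; apply: wN; exists u; first by rewrite /= in_itv /= -(subrK s T).
    by rewrite /curve -E subrK.
  by exists z => //; rewrite flow_final zw subrK.
Qed.

Lemma continuous_curve u : 0 <= u ->
  (curve x : numC R) @[x --> u] --> (curve u : numC R).
Proof.
move=> u0; pose m (f : R -> R) x := Num.max (f x) 0.
have maxc (f : R -> R) : f @ u --> f u -> (m f) @ u --> m f u.
  by move=> fc; apply: (@continuous_max _ _ f (fun=> 0) u) => //; exact: cvg_cst.
have realc (f : R -> R) : f @ u --> f u ->
    ((f x)%:C : numC R) @[x --> u] --> ((f u)%:C : numC R).
  by move=> fc; apply: (cvg_comp f (fun x => x%:C : numC R) fc);
    exact: continuous_real_complex.
have Pc : (arc_chart_path rho r s (T - s) x : numC R) @[x --> u] -->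
    (arc_chart_path rho r s (T - s) u : numC R).
  have hc : (rho%:C + 'i * (slit_height s (T - s) x)%:C : numC R) @[x --> u] -->
      (rho%:C + 'i * (slit_height s (T - s) u)%:C : numC R).
    apply: (@cvgD (numC R)); first exact: cvg_cst.
    apply: (@cvgM (numC R)); first exact: cvg_cst.
    apply: realc; apply: cvgM; first exact: cvg_cst.
    apply: maxc; apply: cvgB; [exact: cvg_id|exact: cvg_cst].
  apply: (@cvgD (numC R)); last first.
    apply: realc; apply: cvgM; first exact: cvg_cst.
    apply: maxc; apply: cvgB; [exact: cvg_cst|exact: cvg_id].
  apply: (@cvg_chart (numC R)) hc.
  apply/eqP => /(congr1 (@complex.Re R)); simpc => /= /eqP.
  by rewrite gt_eqF.
rewrite /curve /arc_inverse.
apply: (@cvgD (numC R)); last exact: cvg_cst.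
apply: (@cvgM (numC R)); last exact: cvg_cst.
apply: (@cvgD (numC R)).
  exact: (@cvg_subc (numC R)).
apply: cvg_sqrtC; last first.
  apply: (@cvgM (numC R)); first exact: Pc.
  exact: (@cvg_subc (numC R)).
have [->|uN0] := eqVneq u 0; last first.
  have : 0 < u by rewrite lt_neqAle eq_sym uN0.
  by move=> /(path_upper rho0 rho_r s0 a0); apply: contra; exact: ltW.
rewrite path_arc ?(ltW a0)// subr0 divff ?(gt_eqF a0)// mulr1.
(* At the foot of the curve the discriminant vanishes. *)
have -> : rho + (r - rho) = r by ring.
by rewrite rmorphM rmorph_nat subrr mulr0 ltxx.
Qed.

Theorem driver_simple_curve : simple_curve_driver0 T (driver rho s).
Proof.
split; last by rewrite driver_before// ltW.
split.
  by apply: continuous_subspaceT; exact: continuous_driver.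
exists flow, curve; split.
- exact: flow_solution.
- apply: continuous_in_subspaceT => u; rewrite inE /= in_itv /= => /andP[u0 _].
  exact: continuous_curve.
- exact: curve_inj.
- split; first exact: curve_start.
  by move=> _ [u + <-]; rewrite /= in_itv /= => /andP[u0 _]; exact: curve_upper.
- exact: conformal_flow.
Qed.
End simple_curve.

Local Close Scope complex_scope.

(** * Uniqueness of real solutions and hitting times *)

Section limf.
Variables (R : realType) (F : set_system R).
Context {FF : ProperFilter F}.
Variable f : R -> R.
Hypothesis f0 : forall u, 0 <= f u.

Lemma limf_einf_cvg0 : f @ F --> 0 -> limf_einf (fun u => (f u)%:E) F = 0%E.
Proof.
move=> /cvgrPdist_lt fF; rewrite limf_einfE; apply/eqP; rewrite eq_le; apply/andP;
  split.
  apply: ge_ereal_sup => _ [V FV <-]; apply/lee_addgt0Pr => e e0.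
  rewrite add0e; have FVe : F (V `&` [set u | `|0 - f u| < e]).
    by apply: filterI => //; exact: fF.
  have [u [Vu /= fu]] := filter_ex FVe.
  apply: ge_ereal_inf; exists (f u)%:E; first by exists u.
  by rewrite lee_fin (le_trans (ler_norm _))// -normrN -sub0r ltW.
apply: ereal_sup_ge; exists (ereal_inf [set (f u)%:E | u in setT]).
  by exists setT => //; exact: filterT.
by apply: le_ereal_inf_tmp => _ [u _ <-]; rewrite lee_fin.
Qed.

Lemma limf_einf_gt0 c : 0 < c -> (\forall u \near F, c <= f u) ->
  limf_einf (fun u => (f u)%:E) F <> 0%E.
Proof.
move=> c0 cf E; have : (c%:E <= limf_einf (fun u => (f u)%:E) F)%E.
  rewrite limf_einfE; apply: ereal_sup_ge.
  exists (ereal_inf [set (f u)%:E | u in [set u | c <= f u]]).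
    by exists [set u | c <= f u].
  by apply: le_ereal_inf_tmp => _ [u cu <-]; rewrite lee_fin.
by rewrite E lee_fin leNgt c0.
Qed.
End limf.

Section real_flow.
Variables (R : realType) (xi : R -> R).
Hypothesis xi_cont : continuous xi.

Section one_solution.
Variables (b x : R) (y : R -> R).
Hypothesis ysol : loewner_solution id `[0, b[ xi x y.

(** Only times of [0, b[ are approached, hence only from the right at 0. *)
Lemma solution_within u : 0 <= u < b -> y @ within `[0, b[ u^' --> y u.
Proof.
move=> ub; have idc (a : R) : idfun x @[x --> a] --> (idfun a : R) by exact: cvg_id.
have [_ yD] := ysol; have [|_ H] := yD u; first by rewrite /= in_itv.
apply: (slope_cvg (increment_cvg0 idc _ _) (increment_neq0 idfun _ _)).
exact: H.
Qed.

Lemma solution_is_derive u : 0 < u < b -> is_derive u 1 y (- 2 / (y u - xi u)).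
Proof.
move=> ub; have /andP[u0 u1] := ub.
have [_ yD] := ysol; have [|_ H] := yD u; first by rewrite /= in_itv /= ltW.
have C : h^-1 *: ((y \o shift u) (h *: (1 : R)) - y u) @[h --> 0^'] -->
    - 2 / (y u - xi u).
  move=> A /H; rewrite /within /= /dnbhs /within /= => HA.
  change (nbhs (0 : R) (fun h => h != 0 ->
     A (h^-1 *: ((y \o shift u) (h *: (1 : R)) - y u)))).
  have sc : (fun h : R => h + u) @ (0 : R) --> u.
    by rewrite -[X in _ --> X]add0r; apply: (@cvgD _ R); [exact: cvg_id|exact: cvg_cst].
  near=> h => h0.
  have hu0 : 0 < h + u by near: h; apply: (sc [set v | 0 < v]); exact: lt_nbhsr.
  have hu1 : h + u < b by near: h; apply: (sc [set v | v < b]); exact: lt_nbhsl.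
  have : h + u != u -> [set` `[0, b[] (h + u) ->
      A ((y (h + u) - y u) / (h + u - u)) by near: h; exact: (sc _ HA).
  rewrite /= in_itv /= hu1 (ltW hu0) -subr_eq0 addrK => /(_ h0 isT).
  by rewrite /= [h *: 1]mulr1 [_ *: _]mulrC.
have Cl : lim (h^-1 *: ((y \o shift u) (h *: (1 : R)) - y u) @[h --> 0^']) =
    - 2 / (y u - xi u) by exact: cvg_lim.
by apply: DeriveDef; [apply/cvg_ex; eexists; exact: C|exact: Cl].
Unshelve. all: by end_near. Qed.

Lemma solution_continuous c : 0 < c < b -> {within `[0, c], continuous y}.
Proof.
move=> /andP[c0 cb]; have H u : 0 < u < b -> {for u, continuous y}.
  by move=> /solution_is_derive[D _]; apply/differentiable_continuous/derivable1_diffP.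
apply/continuous_within_itvP => //; split.
- by move=> u; rewrite in_itv /= => /andP[u0 uc]; apply: H; rewrite u0 (lt_trans uc).
- have := @solution_within 0; rewrite lexx (lt_trans c0 cb) => /(_ isT).
  apply: cvg_trans; apply: cvg_app; move=> A.
  rewrite /within /= /dnbhs /within /= => HA.
  change (nbhs (0 : R) (fun u => 0 < u -> A u)); near=> u => u0.
  have : u != 0 -> [set` `[0, b[] u -> A u by near: u; exact: HA.
  apply; first by rewrite gt_eqF.
  rewrite /= in_itv /= ltW//=; near: u; apply: lt_nbhsl; exact: lt_trans cb.
- by apply: cvg_at_left_filter; apply: H; rewrite c0.
Unshelve. all: by end_near. Qed.

Lemma gap_continuous c : 0 < c < b ->
  {within `[0, c], continuous (fun u => y u - xi u)}.
Proof.
move=> cb; move=> u; apply: cvgB; first exact: (solution_continuous cb).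
by move: u; apply: continuous_subspaceT; exact: xi_cont.
Qed.

Lemma solution_neq u : 0 <= u < b -> y u - xi u != 0.
Proof.
move=> ub; rewrite subr_eq0; have [_ yD] := ysol.
by have [] := yD u; first by rewrite /= in_itv.
Qed.
End one_solution.
End real_flow.

Section real_flow.
Variables (R : realType) (xi : R -> R).
Hypothesis xi_cont : continuous xi.

Lemma gap_gt0 b x y u : loewner_solution id `[0, b[ xi x y -> xi 0 < x ->
  0 <= u < b -> xi u < y u.
Proof.
move=> ysol x0 /andP[u0 ub]; have [y0 _] := ysol.
have [->|uN0] := eqVneq u 0; first by rewrite y0.
have {}u0 : 0 < u by rewrite lt_neqAle eq_sym uN0.
rewrite -subr_gt0 ltNge; apply/negP => yu.
have ucb : 0 < u < b by rewrite u0.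
have [|c cu c0] := IVT (ltW u0) (gap_continuous xi_cont ysol ucb) (v := 0).
  by rewrite y0 ge_min le_max subr_ge0 (ltW x0) yu orbT.
move: cu; rewrite in_itv /= => /andP[cu0 cu1].
have := solution_neq ysol (u := c); rewrite cu0 (le_lt_trans cu1 ub) => /(_ isT).
by rewrite c0 eqxx.
Qed.

(** A sign change of the product would produce, by the intermediate value
    theorem, a time at which one of the solutions meets the driver. *)
Lemma gap_same_sign b x y1 y2 u : x != xi 0 ->
  loewner_solution id `[0, b[ xi x y1 -> loewner_solution id `[0, b[ xi x y2 ->
  0 < u < b -> 0 < (y1 u - xi u) * (y2 u - xi u).
Proof.
move=> x0 s1 s2 ub; have /andP[u0 u1] := ub.
have [y10 _] := s1; have [y20 _] := s2.
rewrite ltNge; apply/negP => yu.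
have cg : {within `[0, u], continuous (fun t => (y1 t - xi t) * (y2 t - xi t))}.
  move=> t; apply: cvgM; [exact: (gap_continuous xi_cont s1 ub)|exact: (gap_continuous xi_cont s2 ub)].
have [|c cu c0] := IVT (ltW u0) cg (v := 0).
  by rewrite y10 y20 ge_min le_max yu orbT -expr2 sqr_ge0.
move: cu; rewrite in_itv /= => /andP[cu0 cu1].
have cb : 0 <= c < b by rewrite cu0 (le_lt_trans cu1 u1).
move/eqP: c0; apply/negP; rewrite mulf_eq0 negb_or.
by rewrite (solution_neq s1 cb) (solution_neq s2 cb).
Qed.

(** Gronwall: the derivative of (y1 - y2)^2 is 4 (y1 - y2)^2 / p, where p is the
    product of the distances to the driver, and p has a positive minimum on a
    compact interval of times. *)
Lemma solution_unique b x y1 y2 u : x != xi 0 ->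
  loewner_solution id `[0, b[ xi x y1 -> loewner_solution id `[0, b[ xi x y2 ->
  0 <= u < b -> y1 u = y2 u.
Proof.
move=> x0 s1 s2 /andP[u0 ub].
have [y10 _] := s1; have [y20 _] := s2.
have [->|uN0] := eqVneq u 0; first by rewrite y10.
have {uN0}u0 : 0 < u by rewrite lt_neqAle eq_sym uN0.
have ucb : 0 < u < b by rewrite u0.
pose p t := (y1 t - xi t) * (y2 t - xi t).
have cp : {within `[0, u], continuous p}.
  by move=> t; apply: cvgM; [exact: (gap_continuous xi_cont s1 ucb)|exact: (gap_continuous xi_cont s2 ucb)].
have p0 t : 0 <= t <= u -> 0 < p t.
  move=> /andP[t0 tu]; have [->|tN0] := eqVneq t 0.
    rewrite /p y10 y20 -expr2 exprn_even_gt0//= subr_eq0; exact: x0.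
  by apply: gap_same_sign s1 s2 _ => //; rewrite lt_neqAle eq_sym tN0 t0 (le_lt_trans tu ub).
have [m mu pm] := EVT_min (ltW u0) cp.
have pm0 : 0 < p m by apply: p0; rewrite in_itv /= in mu.
(* With this constant the derivative of w is at most 0. *)
pose C := 4 / p m.
pose w t := expR (- C * t) * (y1 t - y2 t) ^+ 2.
have dw t : 0 < t < u -> is_derive t 1 w
    (expR (- C * t) * (4 / p t - C) * (y1 t - y2 t) ^+ 2).
  move=> /andP[t0 tu]; have tb : 0 < t < b by rewrite t0 (lt_trans tu).
  have d1 := solution_is_derive s1 tb; have d2 := solution_is_derive s2 tb.
  have := solution_neq s1 (u := t); have := solution_neq s2 (u := t).
  rewrite (ltW t0) (lt_trans tu ub) => /(_ isT) g2 /(_ isT) g1.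
  have de : is_derive t 1 (fun t => expR (- C * t)) (- C * expR (- C * t)).
    have dl : is_derive t 1 (fun t : R => - C * t) (- C).
      by apply: is_derive_eq; rewrite /GRing.scale /=; ring.
    by apply: (is_derive_eq (is_derive1_comp (is_derive_expR _) dl)); rewrite mulrC.
  apply: is_derive_eq.
  rewrite /p /GRing.scale /=; field; by rewrite g1 g2.
have cw : {within `[0, u], continuous w}.
  move=> t; apply: cvgM.
    apply: continuous_subspaceT => v; apply: continuous_comp;
      last exact: continuous_expR.
    by apply: cvgM; [exact: cvg_cst|exact: cvg_id].
  rewrite expr2.
  have cd : {within `[0, u], continuous (fun t => y1 t - y2 t)}.
    move=> v; apply: cvgB; [exact: (solution_continuous s1 ucb)|exact: (solution_continuous s2 ucb)].
  by apply: cvgM; exact: cd.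
have w0 : w u <= w 0.
  apply: (@ler0_derive1_le_cc _ w 0 u) => //.
  - by move=> t; rewrite in_itv /= => /dw[].
  - move=> t; rewrite in_itv /= => tu; have [_ dE] := dw _ tu; rewrite derive1E dE.
    apply: mulr_le0_ge0; last exact: sqr_ge0.
    apply: mulr_ge0_le0; first exact: expR_ge0.
    rewrite subr_le0 /C.
    have tu' : 0 <= t <= u by case/andP: tu => ? ?; rewrite !ltW.
    by rewrite ler_pM2l// lef_pV2 ?posrE ?p0// pm// in_itv.
  - by rewrite in_itv /= lexx ltW.
  - by rewrite in_itv /= lexx ltW.
  - exact: ltW.
move: w0; rewrite /w y10 y20 subrr [0 ^+ 2]expr0n /= mulr0 pmulr_rle0 ?expR_gt0// => h.
by apply/eqP; rewrite -subr_eq0 -sqrf_eq0 eq_le h sqr_ge0.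
Qed.

Lemma solution_restrict b b' x y : b' <= b ->
  loewner_solution id `[0, b[ xi x y -> loewner_solution id `[0, b'[ xi x y.
Proof.
move=> bb [y0 yD]; split=> // t; rewrite /= in_itv /= => /andP[t0 tb].
have [|yt H] := yD t; first by rewrite /= in_itv /= t0 (lt_le_trans tb).
split=> // A /H; rewrite /nbhs /= /within /=; apply: filterS => u;
  rewrite /= !in_itv /= => + /andP[u0 ub].
by apply; rewrite u0 (lt_le_trans ub).
Qed.

Lemma solution_nonincreasing b x y u : loewner_solution id `[0, b[ xi x y ->
  xi 0 < x -> 0 <= u < b -> y u <= x.
Proof.
move=> ysol x0 /andP[u0 ub]; have [y0 _] := ysol.
have [->|uN0] := eqVneq u 0; first by rewrite y0.
have {uN0}u0 : 0 < u by rewrite lt_neqAle eq_sym uN0.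
rewrite -[leRHS]y0; apply: (@ler0_derive1_le_cc _ y 0 u) => //.
- move=> t; rewrite in_itv /= => /andP[t0 tu].
  by have [] := solution_is_derive ysol (u := t); rewrite ?t0 ?(lt_trans tu).
- move=> t; rewrite in_itv /= => /andP[t0 tu].
  have tb : 0 < t < b by rewrite t0 (lt_trans tu).
  have [_ dE] := solution_is_derive ysol tb.
  rewrite derive1E dE mulNr oppr_le0 divr_ge0// subr_ge0 ltW//.
  by apply: gap_gt0 ysol _ _ => //; rewrite ltW//; case/andP: tb.
- by apply: (solution_continuous ysol); rewrite u0.
- by rewrite in_itv /= lexx ltW.
- by rewrite in_itv /= lexx ltW.
- exact: ltW.
Qed.

(** Membership in the set of times whose infimum is the hitting time of a
    point other than xi 0. *)
Definition hits T x t := 0 < t <= T /\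
  exists y : R -> R, loewner_solution id `[0, t[ xi x y /\
    limf_einf (fun s => `|y s - xi s|%:E) (at_left t) = 0%E.

(** A solution living beyond t is continuous and away from the driver at t, and
    up to t it is the only solution. *)
Lemma hits_unique_le T x t t' : x != xi 0 -> hits T x t -> hits T x t' -> t' <= t.
Proof.
move=> x0 [/andP[t0 tT] [y [ys yl]]] [_ [y' [ys' _]]].
rewrite leNgt; apply/negP => tt.
have tb : 0 < t < t' by rewrite t0.
have yE u : 0 <= u < t -> y u = y' u.
  by apply: (solution_unique x0 ys); exact: (solution_restrict (ltW tt)).
have c0 : 0 < `|y' t - xi t| / 2.
  rewrite divr_gt0// normr_gt0; apply: (solution_neq ys').
  by rewrite ltW//=.
have cy : {for t, continuous (fun u => `|y' u - xi u|)}.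
  apply: continuous_comp; last exact: norm_continuous.
  apply: cvgB; last exact: xi_cont.
  have [D _] := solution_is_derive ys' tb.
  exact/differentiable_continuous/derivable1_diffP.
move: yl; apply: (limf_einf_gt0 (c := `|y' t - xi t| / 2)) => //.
(* Half of the limit is a lower bound near t. *)
have near_c : \forall u \near t, `|y' t - xi t| / 2 < `|y' u - xi u|.
  apply: (cy [set v | `|y' t - xi t| / 2 < v]); apply: lt_nbhsr.
  by move: c0; lra.
near=> u; rewrite yE.
  by apply: ltW; near: u; exact: cvg_at_left_filter near_c.
apply/andP; split; [apply: ltW|]; near: u; [exact: nbhs_left_gt|exact: nbhs_left_lt].
Unshelve. all: by end_near. Qed.

Lemma hitting_time_hits T x t : x != xi 0 -> hits T x t -> hitting_time T xi x = t%:E.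
Proof.
move=> x0 ht; rewrite /hitting_time (negbTE x0).
have -> : [set t | 0 < t <= T /\ exists y : R -> R, loewner_solution id `[0, t[ xi x y /\
    limf_einf (fun s => `|y s - xi s|%:E) (at_left t) = 0%E] = [set t].
  apply/seteqP; split => [t' ht'|_ ->//] /=.
  by apply/eqP; rewrite eq_le (hits_unique_le x0 ht ht') (hits_unique_le x0 ht' ht).
by rewrite image_set1 ereal_inf1.
Qed.

Lemma hits_of_hitting_time T x t : x != xi 0 -> hitting_time T xi x = t%:E ->
  hits T x t.
Proof.
move=> x0 ht; have [t' ht'] : exists t', hits T x t'.
  apply: contrapT => no; move: ht; rewrite /hitting_time (negbTE x0).
  have -> : [set t | 0 < t <= T /\ exists y : R -> R, loewner_solution id `[0, t[ xi x y /\
    limf_einf (fun s => `|y s - xi s|%:E) (at_left t) = 0%E] = set0.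
    by apply/seteqP; split => [t' ht'|//]; apply: no; exists t'.
  by rewrite image_set0 ereal_inf0.
by move: (hitting_time_hits x0 ht'); rewrite ht => -[->].
Qed.
End real_flow.

(** * Explicit real solutions *)

Section explicit_hits.
Variables (R : realType) (rho s : R).
Hypotheses (rho0 : 0 < rho) (s0 : 0 <= s).
Implicit Types g X Q b t T : R.

(** The sign g is -1 for points to the left of the driver and 1 for points to
    its right. *)
Definition real_slit (g X t : R) : R := g * Num.sqrt (X ^+ 2 - 4 * t).

Definition real_arc (g Q t : R) : R :=
  g * Num.sqrt (Q * (Q - 4 * radius rho s t)).

Definition real_flow (g X Q t : R) : R :=
  if t <= s then real_slit g X t
  else (Q + real_arc g Q t) / 2 + radius rho s t - 3 * rho.

Lemma continuous_real_slit g X : continuous (real_slit g X).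
Proof.
move=> t; apply: cvgM; first exact: cvg_cst.
apply: (cvg_comp (fun t => X ^+ 2 - 4 * t) Num.sqrt); last exact: sqrt_continuous.
by apply: cvg_affine; exact: cvg_id.
Qed.

Lemma continuous_real_disc (Q : R) :
  continuous (fun t => Q * (Q - 4 * radius rho s t)).
Proof.
move=> t; apply: cvgM; first exact: cvg_cst.
by apply: cvg_affine; exact: continuous_radius.
Qed.

Lemma continuous_real_arc g Q : continuous (real_arc g Q).
Proof.
move=> t; apply: cvgM; first exact: cvg_cst.
apply: (cvg_comp (fun t => Q * (Q - 4 * radius rho s t)) Num.sqrt);
  last exact: sqrt_continuous.
exact: continuous_real_disc.
Qed.

Lemma near_gt0 (f : R -> R) t : {for t, continuous f} -> 0 < f t ->
  \forall u \near t, 0 < f u.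
Proof. by move=> fc ft; apply: (fc [set v | 0 < v]); exact: lt_nbhsr. Qed.

Lemma real_flow_solution g X Q b : g ^+ 2 = 1 -> 0 <= X ->
  (forall t, 0 <= t < b -> t <= s -> 4 * t < X ^+ 2) ->
  (forall t, 0 <= t < b -> s <= t -> 0 < Q * (Q - 4 * radius rho s t)) ->
  (s < b -> real_slit g X s = (Q + real_arc g Q s) / 2 - 2 * rho) ->
  loewner_solution id `[0, b[ (driver rho s) (g * X) (real_flow g X Q).
Proof.
move=> g1 X0 slit_gt0 arc_gt0 match_s.
have g0 : g != 0 by rewrite -sqrf_eq0 g1 oner_eq0.
have idc (a : R) : idfun x @[x --> a] --> (idfun a : R) by exact: cvg_id.
apply: (solution_glue idc (iota := idfun)) => //.
- by rewrite /real_slit mulr0 subr0 sqrtr_sqr ger0_norm.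
- move=> t; rewrite /= in_itv /= => tb ts; have Xt := slit_gt0 _ tb ts.
  have Xt0 : 0 < X ^+ 2 - 4 * t by rewrite subr_gt0.
  split; [|exact: continuous_real_slit|].
    have c : {for t, continuous (fun t : R => X ^+ 2 - 4 * t : R)}.
      by apply: cvg_affine; exact: cvg_id.
    have := near_gt0 c Xt0; apply: filterS => u u0.
    by rewrite /real_slit !exprMn g1 !mul1r sqr_sqrtr ?ltW.
  by rewrite mulf_neq0// gt_eqF// sqrtr_gt0.
- move=> t; rewrite /= in_itv /= => tb st; have Qt := arc_gt0 _ tb st.
  split; [|exact: continuous_real_arc|].
    have := near_gt0 (@continuous_real_disc Q t) Qt.
    by apply: filterS => u u0; rewrite /real_arc exprMn g1 mul1r sqr_sqrtr ?ltW.
  by rewrite mulf_neq0// gt_eqF// sqrtr_gt0.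
- by rewrite /= in_itv /= => /andP[_]; exact: match_s.
Qed.

Lemma hits_of_cvg T x y b : 0 < b <= T ->
  loewner_solution id `[0, b[ (driver rho s) x y ->
  (fun u => y u - driver rho s u) @ b^'- --> 0 -> hits (driver rho s) T x b.
Proof.
move=> bT ys yl; split => //; exists y; split => //.
apply: limf_einf_cvg0 => //.
by rewrite -(@normr0 _ R); apply: cvg_norm.
Qed.

Lemma hits_slit T g X : g ^+ 2 = 1 -> 0 < X -> X ^+ 2 / 4 <= s -> s <= T ->
  hits (driver rho s) T (g * X) (X ^+ 2 / 4).
Proof.
move=> g1 X0 Xs sT; have b0 : 0 < X ^+ 2 / 4 by rewrite divr_gt0// exprn_gt0.
apply: (@hits_of_cvg _ _ (real_flow g X 0)); first by rewrite b0 (le_trans Xs).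
  apply: real_flow_solution => //; first exact: ltW.
  - by move=> t /andP[_ tb] _; move: tb; lra.
  - by move=> t /andP[_ tb] st; move: (lt_le_trans tb (le_trans Xs st)); rewrite ltxx.
  - by move=> sb; move: (lt_le_trans sb Xs); rewrite ltxx.
have <- : real_slit g X (X ^+ 2 / 4) = 0.
  by rewrite /real_slit (_ : _ - _ = 0) ?sqrtr0 ?mulr0//; field.
have c := cvg_at_left_filter (@continuous_real_slit g X (X ^+ 2 / 4)).
apply: (cvg_trans _ c); apply: near_eq_cvg; near=> u.
have us : u <= s by rewrite (le_trans _ Xs)//; near: u; exact: nbhs_left_le.
by rewrite /real_flow us driver_before// subr0.
Unshelve. all: by end_near. Qed.

(** The label 4 r(b) is the one for which the discriminant vanishes at time b:
    the relative position is then r(b), that of the driver. *)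
Lemma hits_arc T g X b : g ^+ 2 = 1 -> 0 <= X -> 4 * s < X ^+ 2 -> s < b <= T ->
  real_slit g X s =
    (4 * radius rho s b + real_arc g (4 * radius rho s b) s) / 2 - 2 * rho ->
  hits (driver rho s) T (g * X) b.
Proof.
move=> g1 X0 Xs /andP[sb bT] match_s; set Q := 4 * radius rho s b.
have b0 : 0 < b := le_lt_trans s0 sb.
apply: (@hits_of_cvg _ _ (real_flow g X Q)); first by rewrite b0.
  apply: real_flow_solution => //.
  - by move=> t _ ts; apply: le_lt_trans Xs; rewrite ler_pM2l.
  - move=> t /andP[t0 tb] st; rewrite /Q -mulrBr !mulr_gt0 ?radius_gt0 ?ltW//.
    rewrite subr_gt0 ltr_sqrt; first by rewrite ltrD2l ltr_pM2l// ltrD2r.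
    by rewrite ltr_wpDr ?exprn_gt0// mulr_ge0// subr_ge0 ltW.
pose d u := (Q + real_arc g Q u) / 2 - 2 * radius rho s u.
have <- : d b = 0.
  by rewrite /d /real_arc subrr mulr0 sqrtr0 /Q; field.
have c : {for b, continuous d}.
  apply: cvgB; last by apply: cvgM; [exact: cvg_cst|exact: continuous_radius].
  apply: cvgM; last exact: cvg_cst.
  by apply: cvgD; [exact: cvg_cst|exact: continuous_real_arc].
apply: (cvg_trans _ (cvg_at_left_filter c)); apply: near_eq_cvg; near=> u.
have us : s < u by near: u; exact: nbhs_left_gt.
by rewrite /real_flow leNgt us /= driver_after ?(ltW us)// /d; field.
Unshelve. all: by end_near. Qed.
End explicit_hits.

(** Subadditivity of the square root. *)
Lemma sqrt_sub (R : realType) (a b : R) : 0 <= b <= a ->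
  Num.sqrt a - Num.sqrt b <= Num.sqrt (a - b).
Proof.
move=> /andP[b0 ab]; rewrite lerBlDl.
rewrite -(@ler_pXn2r _ 2)// ?nnegrE ?addr_ge0 ?sqrtr_ge0//.
rewrite sqrrD !sqr_sqrtr ?subr_ge0 ?(le_trans b0 ab)//.
have : 0 <= Num.sqrt b * Num.sqrt (a - b) by rewrite mulr_ge0 ?sqrtr_ge0.
lra.
Qed.

(** The square root turns a delay by s' - s into a change of order
    sqrt(s' - s), uniformly in rho. *)
Lemma driver_dist (R : realType) (rho s s' t : R) : s <= s' ->
  `|driver rho s t - driver rho s' t| <= 3 * Num.sqrt (2 * (s' - s)).
Proof.
move=> ss; have [m1 m2] : Num.max s' t - s' <= Num.max s t - s /\
    (Num.max s t - s) - (Num.max s' t - s') <= s' - s.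
  by case: (leP s' t); case: (leP s t) => *; lra.
have m0 : 0 <= Num.max s' t - s' by rewrite subr_ge0 le_max lexx.
rewrite /driver -mulrBr normrM ger0_norm// ler_pM2l// opprB addrA subrK /radius.
set a := _ + 2 * (Num.max s t - s); set b := _ + 2 * (Num.max s' t - s').
have b0 : 0 <= b by rewrite addr_ge0 ?sqr_ge0// mulr_ge0.
have ba : b <= a by rewrite lerD2l ler_pM2l.
rewrite ger0_norm ?subr_ge0 ?ler_wsqrtr//.
rewrite (le_trans (@sqrt_sub _ _ _ _)) ?b0// ler_wsqrtr//.
by rewrite /a /b; lra.
Qed.

Lemma sup_norm_le (R : realType) (T : R) (f : R -> R) c : 0 <= T ->
  (forall t, 0 <= t <= T -> `|f t| <= c) -> 0 <= sup_norm T f <= c.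
Proof.
move=> T0 fc; have T00 : [set `|f t| | t in `[0, T]] `|f 0|.
  by exists 0 => //; rewrite /= in_itv /= lexx.
have ub : ubound [set `|f t| | t in `[0, T]] c.
  by move=> _ [t + <-]; rewrite /= in_itv /=; exact: fc.
apply/andP; split; last by apply: ge_sup => //; exists `|f 0|.
apply: (le_trans (normr_ge0 (f 0))); apply: ub_le_sup => //.
by exists c.
Qed.

(** * The two weldings *)

(** The inverse is meaningful as soon as one nonnegative point y0 has the
    hitting time of x. *)
Lemma welding_mem (R : realType) (T : R) (xi : R -> R) (x y0 : R) :
  0 <= y0 -> hitting_time T xi y0 = hitting_time T xi x -> welded T xi x ->
  let y := conformal_welding T xi x in
  0 <= y /\ hitting_time T xi y = hitting_time T xi x.
Proof.
move=> y00 yx xw y.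
have H : [set hitting_time T xi y | y in [set y | 0 <= y /\ welded T xi y]]
    (hitting_time T xi x).
  by exists y0 => //; split => //; rewrite /welded yx.
split; last by apply: pinvK; rewrite inE.
have sub := @surjpinv_image_sub _ _ (fun=> point)
  [set y | 0 <= y /\ welded T xi y] _ (hitting_time T xi) (fun _ h => h).
by have [] := sub y; first by exists (hitting_time T xi x).
Qed.

Section welding_values.
Variables (R : realType) (rho s : R).
Hypotheses (rho0 : 0 < rho) (s0 : 0 <= s).
Implicit Types x y T b : R.
Let xi := driver rho s.

Let xi0 : xi 0 = 0. Proof. by rewrite /xi driver_before. Qed.

(** Before time b the solution stays above the driver and does not increase,
    so y is above all values of the driver before b. *)
Lemma hits_partner_ge T y b : 0 < y -> s < b -> hits xi T y b -> xi b <= y.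
Proof.
move=> y0 sb [/andP[b0 bT] [yy [ys _]]]; rewrite leNgt; apply/negP => yb.
have near_b : \forall u \near b, y < xi u.
  by apply: (@continuous_driver _ rho s b [set v | y < v]); exact: lt_nbhsr.
have near_l : \forall u \near b^'-, y < xi u /\ 0 <= u < b.
  near=> u; split; first by near: u; exact: cvg_at_left_filter near_b.
  apply/andP; split; [apply: ltW|]; near: u; [exact: nbhs_left_gt|exact: nbhs_left_lt].
have [u [yu ub]] := @filter_ex _ _ (at_left_proper_filter b) _ near_l.
have xy : xi 0 < y by rewrite xi0.
have := lt_le_trans (gap_gt0 (@continuous_driver _ rho s) ys xy ub)
   (solution_nonincreasing (@continuous_driver _ rho s) ys xy ub).
by move=> /(lt_trans yu); rewrite ltxx.
Unshelve. all: by end_near. Qed.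

(** Otherwise the solution sqrt(y^2 - 4 t) is still away from 0 at time b. *)
Lemma hits_slit_le T y b : 0 < y -> b <= s -> hits xi T y b -> y ^+ 2 <= 4 * b.
Proof.
move=> y0 bs [/andP[b0 bT] [yy [ys yl]]]; rewrite leNgt; apply/negP => yb.
have sol : loewner_solution id `[0, b[ xi (1 * y) (real_flow rho s 1 y 0).
  apply: real_flow_solution => //; rewrite ?expr1n//; first exact: ltW.
  - by move=> t /andP[_ tb] _; move: tb yb; lra.
  - by move=> t /andP[_ tb] st; move: (lt_le_trans tb (le_trans bs st)); rewrite ltxx.
  - by move=> sb; move: (lt_le_trans sb bs); rewrite ltxx.
rewrite mul1r in sol.
have xy : y != xi 0 by rewrite xi0 gt_eqF.
move: yl; apply: (limf_einf_gt0 (c := Num.sqrt (y ^+ 2 - 4 * b))) => //.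
  by rewrite sqrtr_gt0 subr_gt0.
near=> u.
have ub : 0 <= u < b.
  apply/andP; split; [apply: ltW|]; near: u; [exact: nbhs_left_gt|exact: nbhs_left_lt].
have us : u <= s by case/andP: ub => _ ub; rewrite (le_trans (ltW ub)).
rewrite (solution_unique (@continuous_driver _ rho s) xy ys sol ub).
rewrite /real_flow us /xi driver_before// subr0 /real_slit mul1r ger0_norm ?sqrtr_ge0//.
by rewrite ler_wsqrtr// lerD2l lerN2 ler_pM2l// ltW//; case/andP: ub.
Unshelve. all: by end_near. Qed.
End welding_values.

Section slow_driver.
Variables (R : realType) (rho T : R).
Hypotheses (rho0 : 0 < rho) (T1 : 1 <= T).
Let xi := driver rho 1.

Lemma slow_hitting_time : hitting_time T xi (- 2) = 1%:E /\ hitting_time T xi 2 = 1%:E.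
Proof.
have x0 : xi 0 = 0 by rewrite /xi driver_before.
have E : (2 : R) ^+ 2 / 4 = 1 by field.
have H g : g ^+ 2 = 1 -> hits xi T (g * 2) 1.
  by move=> g1; rewrite -[X in hits _ _ _ X]E; apply: hits_slit => //; rewrite E.
split; apply: hitting_time_hits; try exact: continuous_driver.
- by rewrite x0 oppr_eq0.
- by rewrite -mulN1r; apply: H; rewrite sqrrN expr1n.
- by rewrite x0.
- by rewrite -[X in hits _ _ X _]mul1r; apply: H; rewrite expr1n.
Qed.

(** Both -2 and 2 are hit at time 1, and a point to the right of 2 cannot be
    hit at this time. *)
Lemma slow_welding : welded T xi (- 2) /\ conformal_welding T xi (- 2) <= 2.
Proof.
have [l r] := slow_hitting_time; have w : welded T xi (- 2) by rewrite /welded l ltry.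
have [] := welding_mem _ _ w (y0 := 2) => //; first by rewrite l r.
set y := conformal_welding _ _ _ => y0; rewrite l => yt; split => //.
have x0 : xi 0 = 0 by rewrite /xi driver_before.
have [->//|yN0] := eqVneq y 0.
have {yN0}y0 : 0 < y by rewrite lt_neqAle eq_sym yN0.
have h : hits xi T y 1.
  by apply: hits_of_hitting_time yt; [exact: continuous_driver|rewrite x0 gt_eqF].
have := hits_slit_le rho0 ler01 y0 (lexx _) h.
have -> : 4 * 1 = (2 : R) ^+ 2 by ring.
by rewrite ler_pXn2r ?nnegrE// ltW.
Qed.
End slow_driver.

Section fast_driver.
Variables (R : realType) (e T : R).
Hypotheses (e0 : 0 < e) (e8 : e <= 8^-1) (T5 : 5 <= T).
(** The solution from -2 is at distance 2 sqrt(1 - s) = 8 e (1 - e) from the driver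
    at time s, so its relative position is k = rho - 8 e (1 - e) = 8 e^2, slightly to
    the right of the position k = 0 which would never be hit.  Its label is
    (k + rho)^2 / k = 8 (1 + e)^2, and b is the time at which the radius is a quarter
    of this.  The bound 1 / 8 on e leaves s positive, b below 5, and the driver
    above 3 at time b. *)
Let rho := 8 * e.
Let s := 1 - 16 * e ^+ 2 * (1 - e) ^+ 2.
Let xi := driver rho s.
Let b := s + ((2 * (1 + e) ^+ 2) ^+ 2 - rho ^+ 2) / 2.

Let rho0 : 0 < rho. Proof. by rewrite mulr_gt0. Qed.

Let e1 : 0 <= 1 - e <= 1. Proof. by move: e0 e8; lra. Qed.

Let sqr_e : 0 <= 16 * e ^+ 2 * (1 - e) ^+ 2 <= 1 / 4.
Proof.
have /andP[h0 h1] := e1.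
have k : 0 <= e ^+ 2 * (1 - e) ^+ 2 by rewrite mulr_ge0 ?sqr_ge0.
have : e ^+ 2 * (1 - e) ^+ 2 <= e ^+ 2.
  by rewrite ler_piMr ?sqr_ge0//; exact: exprn_ile1.
have : e ^+ 2 <= (8^-1) ^+ 2 by rewrite ler_pXn2r// ?nnegrE ?ltW.
by move: k; lra.
Qed.

Let s_bounds : 1 / 2 <= s <= 1.
Proof. by move: sqr_e; rewrite /s; lra. Qed.

Let hit_radius : 2 <= 2 * (1 + e) ^+ 2 <= 81 / 32.
Proof. by move: e0 e8; nra. Qed.

Let sb : s < b.
Proof.
rewrite ltrDl divr_gt0// subr_gt0 ltr_pXn2r ?nnegrE ?ltW//.
  by move: hit_radius e8; rewrite /rho; lra.
by move: hit_radius; lra.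
Qed.

Let bT : b <= T.
Proof.
have : (2 * (1 + e) ^+ 2) ^+ 2 <= (81 / 32) ^+ 2.
  by rewrite ler_pXn2r ?nnegrE//; case/andP: hit_radius; lra.
have := sqr_ge0 rho; case/andP: s_bounds; move: T5; rewrite /b; lra.
Qed.

Let radius_b : radius rho s b = 2 * (1 + e) ^+ 2.
Proof.
rewrite /radius /b (_ : _ + _ = (2 * (1 + e) ^+ 2) ^+ 2); last by field.
by rewrite sqrtr_sqr ger0_norm// mulr_ge0// sqr_ge0.
Qed.

Let arcE g : real_arc rho s g (4 * radius rho s b) s = g * (8 * (1 - e ^+ 2)).
Proof.
rewrite /real_arc radius_start// radius_b /rho; congr (_ * _).
have -> : 4 * (2 * (1 + e) ^+ 2) * (4 * (2 * (1 + e) ^+ 2) - 4 * (8 * e)) =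
  (8 * (1 - e ^+ 2)) ^+ 2 by ring.
by rewrite sqrtr_sqr ger0_norm// mulr_ge0// subr_ge0; move: e0 e8; nra.
Qed.

(** The point whose solution is at distance 8 (1 - e) to the right of the driver at
    time s, i.e. has relative position 8. *)
Let partner := Num.sqrt ((8 * (1 - e)) ^+ 2 + 4 * s).

(** The relative positions of the two solutions at time s are 8 e^2 and 8;
    their product is rho^2 = (8 e)^2, so they have the same label. *)
Lemma fast_hits : hits xi T (- 2) b /\ hits xi T partner b.
Proof.
have s0 : 0 <= s by case/andP: s_bounds; lra.
have E1 : (2 : R) ^+ 2 - 4 * s = (8 * e * (1 - e)) ^+ 2 by rewrite /s; ring.
have p0 : 0 <= (8 * (1 - e)) ^+ 2 + 4 * s by rewrite addr_ge0 ?sqr_ge0// mulr_ge0.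
have E2 : partner ^+ 2 - 4 * s = (8 * (1 - e)) ^+ 2.
  by rewrite /partner sqr_sqrtr// addrK.
split.
  rewrite -mulN1r; apply: hits_arc; rewrite ?sb ?bT ?sqrrN ?expr1n//.
    by rewrite -subr_gt0 E1 exprn_gt0// !mulr_gt0//; move: e8; lra.
  rewrite arcE radius_b /real_slit E1 sqrtr_sqr ger0_norm.
    by rewrite /rho; field.
  by rewrite !mulr_ge0//; [exact: ltW|case/andP: e1].
rewrite -[partner]mul1r; apply: hits_arc; rewrite ?sb ?bT ?expr1n ?sqrtr_ge0//.
  by rewrite -subr_gt0 E2 exprn_gt0// mulr_gt0//; move: e8; lra.
rewrite arcE radius_b /real_slit E2 sqrtr_sqr ger0_norm.
  by rewrite /rho; field.
by rewrite mulr_ge0//; case/andP: e1.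
Qed.

Lemma fast_welding : welded T xi (- 2) /\ 3 <= conformal_welding T xi (- 2).
Proof.
have s0 : 0 <= s by case/andP: s_bounds; lra.
have x0 : xi 0 = 0 by rewrite /xi driver_before.
have b0 : 0 < b := le_lt_trans s0 sb.
have [hl hr] := fast_hits.
have p0 : 0 < partner.
  by rewrite sqrtr_gt0 ltr_wpDl ?sqr_ge0// mulr_gt0//; case/andP: s_bounds; lra.
have l : hitting_time T xi (- 2) = b%:E.
  by apply: hitting_time_hits => //; [exact: continuous_driver|rewrite x0 oppr_eq0].
have r : hitting_time T xi partner = b%:E.
  by apply: hitting_time_hits => //; [exact: continuous_driver|rewrite x0 gt_eqF].
have w : welded T xi (- 2) by rewrite /welded l ltry.
have [] := welding_mem _ _ w (y0 := partner); [exact: ltW|by rewrite l r|].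
set y := conformal_welding _ _ _ => y0; rewrite l => yt; split => //.
have yN0 : y != 0.
  apply/eqP => yE; move: yt; rewrite yE /hitting_time x0 eqxx => -[bE].
  by rewrite -bE ltxx in b0.
have {}y0 : 0 < y by rewrite lt_neqAle eq_sym yN0.
have h : hits xi T y b.
  by apply: hits_of_hitting_time yt; [exact: continuous_driver|rewrite x0 gt_eqF].
have := hits_partner_ge rho0 s0 y0 sb h; apply: le_trans.
rewrite /xi driver_after ?(ltW sb)// radius_b /rho.
by move: e0 e8; nra.
Qed.

Lemma fast_simple : simple_curve_driver0 T xi.
Proof.
apply: driver_simple_curve => //; first by case/andP: s_bounds; lra.
exact: lt_le_trans sb bT.
Qed.

Lemma fast_slow_dist t : `|xi t - driver rho 1 t| <= 18 * e.
Proof.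
have /andP[_ s1] := s_bounds.
apply: (le_trans (driver_dist rho t s1)).
have -> : 18 * e = 3 * Num.sqrt ((6 * e) ^+ 2).
  by rewrite sqrtr_sqr ger0_norm; [ring|rewrite mulr_ge0// ltW].
rewrite ler_pM2l// ler_wsqrtr// /s.
have : e ^+ 2 * (1 - e) ^+ 2 <= e ^+ 2.
  by rewrite ler_piMr ?sqr_ge0//; case/andP: e1 => *; exact: exprn_ile1.
have := sqr_ge0 e; lra.
Qed.
End fast_driver.

Theorem lemma4p5 (R : realType) :
  exists (T : R) (xi xi' : nat -> R -> R),
    [/\ 0 < T,
        forall n, simple_curve_driver0 T (xi n),
        forall n, simple_curve_driver0 T (xi' n),
        sup_norm T (xi n \- xi' n) @[n --> \oo] --> (0 : R)
      & exists (x eps : R),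
          [/\ x <= 0,
              forall n, welded T (xi n) x /\ welded T (xi' n) x,
              0 < eps
            & forall n, eps <=
                `|conformal_welding T (xi n) x - conformal_welding T (xi' n) x|]].
Proof.
pose e n : R := (n + 8)%:R^-1.
have e0 n : 0 < e n by rewrite invr_gt0 ltr0n addn_gt0 orbT.
have e8 n : e n <= 8^-1.
  by rewrite /e lef_pV2 ?posrE ?ltr0n ?addn_gt0 ?orbT// ler_nat leq_addl.
exists 5, (fun n => driver (8 * e n) (1 - 16 * e n ^+ 2 * (1 - e n) ^+ 2)).
exists (fun n => driver (8 * e n) 1); split => //.
- by move=> n; exact: fast_simple.
- by move=> n; apply: driver_simple_curve => //; [rewrite mulr_gt0|rewrite ltr1n].
- apply: (@squeeze_cvgr _ _ _ _ (fun=> 0) (fun n => 18 * harmonic n)).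
  + near=> n; apply: sup_norm_le => // t _.
    apply: (le_trans (fast_slow_dist (e0 n) (e8 n) t)).
    rewrite ler_pM2l// /e /harmonic /= lef_pV2 ?posrE ?ltr0n ?addn_gt0 ?orbT//.
    by rewrite ler_nat -addn1 leq_add2l.
  + exact: cvg_cst.
  + rewrite -[X in _ --> X](mulr0 18); apply: cvgM; first exact: cvg_cst.
    exact: cvg_harmonic.
- exists (- 2), 1; split => //.
  + move=> n; split; first exact: (fast_welding (e0 n) (e8 n) (lexx 5)).1.
    by apply: (slow_welding _ _).1; [rewrite mulr_gt0|rewrite ler1n].
  + move=> n; have [_ f] := fast_welding (e0 n) (e8 n) (lexx 5).
    have r0 : 0 < 8 * e n by rewrite mulr_gt0.
    have T1 : (1 : R) <= 5 by rewrite ler1n.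
    have [_ g] := slow_welding r0 T1.
    apply: le_trans (ler_norm _); move: f g; lra.
Unshelve. all: by end_near. Qed.
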